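(* Let $k$ be an algebraically closed field of characteristic $p>0$ and let $\mathcal{G}$ be a finite group scheme over $k$ whose center $Z(\mathcal{G})$ satisfies $\mathrm{rk}_{au}(Z(\mathcal{G}))\ge 2$. If $M$ is a finite-dimensional $\mathcal{G}$-module of constant rank such that $M|_{Z(\mathcal{G})}$ has the equal images property (as a $Z(\mathcal{G})$-module), then $M$ has the equal images property.
   Context: For a finite group scheme $\mathcal{G}$, $k\mathcal{G}=k[\mathcal{G}]^\ast$ is its algebra of measures; $\mathcal{G}$-modules are $k\mathcal{G}$-modules; for $u\in k\mathcal{G}$, $u_M$ is the operator $m\mapsto um$ on $M$. Let $\mathfrak{A}_p=k[T]/(T^p)$, $t=T+(T^p)$. A $p$-point of $\mathcal{G}$ is an algebra homomorphism $\alpha:\mathfrak{A}_p\to k\mathcal{G}$ such that $k\mathcal{G}$ is projective as a left $\mathfrak{A}_p$-module via $\alpha$, and $\mathrm{im}\,\alpha\subseteq k\mathcal{U}$ for some abelian unipotent subgroup scheme $\mathcal{U}\subseteq\mathcal{G}$. $M$ has constant rank if $\mathrm{rk}(\alpha(t)_M)$ is the same for all $p$-points $\alpha$ of $\mathcal{G}$. $M$ has the equal images property if for every $\ell\in\{1,\ldots,p-1\}$ there is a subspace $V_\ell\subseteq M$ with $\mathrm{im}\,\alpha(t)_M^\ell=V_\ell$ for all $p$-points $\alpha$ of $\mathcal{G}$. Two $p$-points $\alpha,\beta$ of $\mathcal{G}$ are equivalent if for every finite-dimensional $\mathcal{G}$-module $N$, $\alpha^\ast(N)$ is projective if and only if $\beta^\ast(N)$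 is projective. $\mathrm{P}(\mathcal{G})$ is the set of equivalence classes; it is a noetherian topological space whose closed sets are the sets $\{[\alpha] : \alpha^\ast(N)\text{ not projective}\}$, $N$ a finite-dimensional $\mathcal{G}$-module. The abelian unipotent rank is $\mathrm{rk}_{au}(\mathcal{G})=\max\{\dim\mathrm{P}(\mathcal{U})+1 : \mathcal{U}\subseteq\mathcal{G}\text{ abelian unipotent subgroup}\}$. *)

(* Defs.v *)
From HB Require Import structures.
From mathcomp Require Import all_boot all_order all_algebra all_field.
From mathcomp Require Import boolp classical_sets.

Set Implicit Arguments.
Unset Strict Implicit.
Unset Printing Implicit Defensive.

Import GRing.Theory.

Local Open Scope ring_scope.

(* [tensor V W] is the space V (x) W written in coordinates: the entry (i, j) *)
(* of a tensor is its coordinate on e_i (x) f_j, where e and f are the chosen *)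
(* bases of V and W. [tlift b] is the linear map on V (x) W induced by b, and *)
(* is meaningful (tlift_pure) when b is bilinear, as it is in every use       *)
(* below.                                                                     *)
Section Tensor.

Variables (k : fieldType) (V W : vectType k).

Definition tensor := 'M[k]_(\dim {:V}, \dim {:W}).

Definition tpure (v : V) (w : W) : tensor :=
  \matrix_(i, j) (coord (vbasis {:V}) i v * coord (vbasis {:W}) j w).

Definition tlift (U : lmodType k) (b : V -> W -> U) (T : tensor) : U :=
  \sum_i \sum_j T i j *: b (vbasis {:V})`_i (vbasis {:W})`_j.

Fact tlift_is_linear (U : lmodType k) (b : V -> W -> U) : linear (tlift b).
Proof.
move=> c S T; rewrite /tlift scaler_sumr -big_split; apply: eq_bigr => i _ /=.
rewrite scaler_sumr -big_split; apply: eq_bigr => j _ /=.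
by rewrite !mxE scalerDl scalerA.
Qed.
HB.instance Definition _ (U : lmodType k) (b : V -> W -> U) :=
  GRing.isLinear.Build k tensor U _ (tlift b) (tlift_is_linear b).

Lemma eq_tlift (U : lmodType k) (b c : V -> W -> U) T :
  (forall v w, b v w = c v w) -> tlift b T = tlift c T.
Proof.
by move=> bc; apply: eq_bigr => i _; apply: eq_bigr => j _; rewrite bc.
Qed.

Lemma linear_tlift (U U' : lmodType k) (f : {linear U -> U'})
    (b : V -> W -> U) T :
  f (tlift b T) = tlift (fun v w => f (b v w)) T.
Proof.
rewrite linear_sum; apply: eq_bigr => i _.
by rewrite linear_sum; apply: eq_bigr => j _; rewrite linearZ.
Qed.

Lemma scaler_tlift (U : lmodType k) c (b : V -> W -> U) T :
  c *: tlift b T = tlift (fun v w => c *: b v w) T.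
Proof.
rewrite scaler_sumr; apply: eq_bigr => i _; rewrite scaler_sumr.
by apply: eq_bigr => j _; rewrite !scalerA mulrC.
Qed.

Lemma mulr_tlift (c : k^o) (b : V -> W -> k^o) T :
  c * tlift b T = tlift (fun v w => c * b v w) T.
Proof. exact: scaler_tlift. Qed.

Lemma tliftD (U : lmodType k) (b c : V -> W -> U) T :
  tlift (fun v w => b v w + c v w) T = tlift b T + tlift c T.
Proof.
rewrite -big_split; apply: eq_bigr => i _.
by rewrite -big_split; apply: eq_bigr => j _; rewrite scalerDr.
Qed.

Lemma tlift_pure (U : lmodType k) (b : V -> W -> U) v w :
  (forall w, linear (b^~ w)) -> (forall v, linear (b v)) ->
  tlift b (tpure v w) = b v w.
Proof.
move=> bl br.
pose L w' := GRing.isLinear.Build k V U _ (b^~ w') (bl w').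
pose fL w' : {linear V -> U} := HB.pack (b^~ w') (L w').
pose R v' := GRing.isLinear.Build k W U _ (b v') (br v').
pose fR v' : {linear W -> U} := HB.pack (b v') (R v').
rewrite {2}(coord_vbasis (memvf v)) -[b _ w]/(fL w _) linear_sum.
apply: eq_bigr => i _; rewrite linearZ /=.
rewrite [X in b _ X](coord_vbasis (memvf w)) -[b _ _]/(fR _ _) linear_sum.
rewrite scaler_sumr; apply: eq_bigr => j _.
by rewrite linearZ /= scalerA mxE.
Qed.

Lemma tlift_tpure T : tlift tpure T = T.
Proof.
have Vf := basis_free (vbasisP {:V}); have Wf := basis_free (vbasisP {:W}).
apply/matrixP => i j; rewrite summxE (bigD1 i) //= summxE (bigD1 j) //=.
rewrite !mxE !coord_free // !eqxx !mulr1 !big1 ?addr0 //.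
  move=> i' /negPf ii'; rewrite summxE big1 // => j' _.
  by rewrite !mxE !coord_free // ii' mul0r mulr0.
by move=> j' /negPf jj'; rewrite !mxE !coord_free // jj' !mulr0.
Qed.

End Tensor.

(* A finite group scheme, given by its coordinate ring k[G], a finite-        *)
(* dimensional commutative Hopf algebra.                                      *)
Record finGroupScheme (k : fieldType) := FinGroupScheme {
  coordRing : falgType k;
  comul : {linear coordRing -> tensor coordRing coordRing};
  counit : {lrmorphism coordRing -> k^o};
  antipode : {linear coordRing -> coordRing};
  coordRing_mulC : forall a b : coordRing, a * b = b * a;
  comul1 : comul 1 = tpure 1 1;
  comulM : forall a b, comul (a * b) =
    tlift (fun x y => tlift (fun x' y' => tpure (x * x') (y * y')) (comul b))
          (comul a);
  comulA : forall a,
    tlift (fun x y => tpure x (comul y)) (comul a) =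
    tlift (fun x y => tlift (fun x1 x2 => tpure x1 (tpure x2 y)) (comul x))
          (comul a);
  counitl : forall a, tlift (fun x y => (counit x : k) *: y) (comul a) = a;
  counitr : forall a, tlift (fun x y => (counit y : k) *: x) (comul a) = a;
  antipodel : forall a,
    tlift (fun x y => antipode x * y) (comul a) = (counit a : k)%:A;
  antipoder : forall a,
    tlift (fun x y => x * antipode y) (comul a) = (counit a : k)%:A
}.

(* [measures G] is k[G]^* with the convolution product.                       *)
Definition measures (k : fieldType) (G : finGroupScheme k) : Type :=
  'Hom(coordRing G, k^o).

Section Measures.

Variables (k : fieldType) (G : finGroupScheme k).
Local Notation A := (coordRing G).

HB.instance Definition _ := Vector.copy (measures G) 'Hom(A, k^o).

Definition meas_fun (u : measures G) : {linear A -> k^o} :=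
  (u : 'Hom(A, k^o)).

Definition meas_conv_fun (u v : measures G) (a : A) : k^o :=
  tlift (fun x y => meas_fun u x * meas_fun v y) (comul G a).

Fact meas_conv_fun_is_linear u v : linear (meas_conv_fun u v).
Proof. by move=> c a b; rewrite /meas_conv_fun !linearP. Qed.
HB.instance Definition _ u v :=
  GRing.isLinear.Build k A k^o _ (meas_conv_fun u v)
    (meas_conv_fun_is_linear u v).

Definition meas_one : measures G := linfun (counit G).
Definition meas_mul (u v : measures G) : measures G :=
  linfun (meas_conv_fun u v).

Lemma measP (u v : measures G) : meas_fun u =1 meas_fun v -> u = v.
Proof. by move=> uv; apply/lfunP. Qed.

Lemma meas_oneE a : meas_fun meas_one a = counit G a.
Proof. exact: lfunE. Qed.

Lemma meas_mulE u v a : meas_fun (meas_mul u v) a =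
  tlift (fun x y => meas_fun u x * meas_fun v y) (comul G a).
Proof. exact: lfunE. Qed.

Lemma meas_addE u v a : meas_fun (u + v) a = meas_fun u a + meas_fun v a.
Proof. exact: add_lfunE. Qed.

Lemma meas_scaleE c u a : meas_fun (c *: u) a = c * meas_fun u a.
Proof. exact: scale_lfunE. Qed.

Fact meas_mulA : associative meas_mul.
Proof.
move=> u v w; apply: measP => a; rewrite !meas_mulE.
pose b2 y z : k^o := meas_fun v y * meas_fun w z.
pose b3 x (T : tensor A A) : k^o := meas_fun u x * tlift b2 T.
have b2l z : linear (b2^~ z).
  by move=> c x y; rewrite /b2 linearP mulrDl -mulrA.
have b2r y : linear (b2 y).
  by move=> c x z; rewrite /b2 linearP mulrDr mulrCA.
have b3l T : linear (b3^~ T).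
  by move=> c x y; rewrite /b3 linearP mulrDl -mulrA.
have b3r x : linear (b3 x).
  by move=> c S T; rewrite /b3 linearP mulrDr mulrCA.
have := congr1 (tlift b3) (comulA a); rewrite !linear_tlift => E.
transitivity (tlift (fun x y => tlift b3 (tpure x (comul G y))) (comul G a)).
  by apply: eq_tlift => x y; rewrite tlift_pure // /b3 meas_mulE.
rewrite {}E; apply: eq_tlift => x y; rewrite linear_tlift meas_mulE mulrC.
rewrite mulr_tlift.
apply: eq_tlift => x1 x2; rewrite /= tlift_pure // /b3 tlift_pure //.
by rewrite /b2 mulrA [RHS]mulrC.
Qed.

Fact meas_mul1 : left_id meas_one meas_mul.
Proof.
move=> u; apply: measP => a; rewrite meas_mulE -[in RHS](counitl a).
rewrite linear_tlift; apply: eq_tlift => x y.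
by rewrite linearZ /= meas_oneE.
Qed.

Fact meas_mulr1 : right_id meas_one meas_mul.
Proof.
move=> u; apply: measP => a; rewrite meas_mulE -[in RHS](counitr a).
rewrite linear_tlift; apply: eq_tlift => x y.
by rewrite linearZ /= meas_oneE mulrC.
Qed.

Fact meas_mulDl : left_distributive meas_mul +%R.
Proof.
move=> u v w; apply: measP => a; rewrite meas_addE !meas_mulE -tliftD.
by apply: eq_tlift => x y; rewrite meas_addE mulrDl.
Qed.

Fact meas_mulDr : right_distributive meas_mul +%R.
Proof.
move=> u v w; apply: measP => a; rewrite meas_addE !meas_mulE -tliftD.
by apply: eq_tlift => x y; rewrite meas_addE mulrDr.
Qed.

Fact meas_one_neq0 : meas_one != 0.
Proof.
apply/eqP => /(congr1 (fun u => meas_fun u 1)) /eqP.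
by rewrite meas_oneE rmorph1 [meas_fun _ _]zero_lfunE oner_eq0.
Qed.

HB.instance Definition _ := GRing.Zmodule_isNzRing.Build (measures G)
  meas_mulA meas_mul1 meas_mulr1 meas_mulDl meas_mulDr meas_one_neq0.

Fact meas_scaleAl c (u v : measures G) : c *: (u * v) = c *: u * v.
Proof.
apply: measP => a; rewrite meas_scaleE !meas_mulE.
rewrite mulr_tlift.
by apply: eq_tlift => x y; rewrite meas_scaleE -mulrA.
Qed.
HB.instance Definition _ :=
  GRing.Lmodule_isLalgebra.Build k (measures G) meas_scaleAl.

Fact meas_scaleAr c (u v : measures G) : c *: (u * v) = u * (c *: v).
Proof.
apply: measP => a; rewrite meas_scaleE !meas_mulE.
rewrite mulr_tlift.
by apply: eq_tlift => x y; rewrite meas_scaleE [RHS]mulrCA.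
Qed.
HB.instance Definition _ :=
  GRing.Lalgebra_isAlgebra.Build k (measures G) meas_scaleAr.
HB.instance Definition _ := Algebra_isFalgebra.Build k (measures G).

End Measures.

(* A closed subgroup scheme of G: a finite group scheme H together with a     *)
(* surjective homomorphism of Hopf algebras k[G] -> k[H].                     *)
Record subgroupScheme (k : fieldType) (G : finGroupScheme k) := SubgroupScheme {
  subgroup :> finGroupScheme k;
  restr : {lrmorphism coordRing G -> coordRing subgroup};
  restr_surj : forall b, exists a, restr a = b;
  restr_comul : forall a,
    comul subgroup (restr a) =
    tlift (fun x y => tpure (restr x) (restr y)) (comul G a);
  restr_counit : forall a, counit subgroup (restr a) = counit G a
}.

(* The inclusion of measure algebras kH -> kG, the transpose of restr.        *)
Section Inclusion.

Variables (k : fieldType) (G : finGroupScheme k) (H : subgroupScheme G).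

Definition incl (u : measures H) : measures G :=
  linfun (meas_fun u \o restr H).

Lemma inclE u a : meas_fun (incl u) a = meas_fun u (restr H a).
Proof. exact: lfunE. Qed.

Fact incl_is_linear : linear incl.
Proof.
move=> c u v; apply: measP => a.
by rewrite inclE !meas_addE !meas_scaleE !inclE.
Qed.
HB.instance Definition _ :=
  GRing.isLinear.Build k (measures H) (measures G) _ incl incl_is_linear.

Fact incl_is_monoid_morphism : monoid_morphism incl.
Proof.
split=> [|u v]; apply: measP => a.
  by rewrite inclE !meas_oneE restr_counit.
rewrite inclE !meas_mulE restr_comul linear_tlift.
apply: eq_tlift => x y; rewrite [LHS]tlift_pure ?inclE //.
  by move=> w c x' y'; rewrite linearP mulrDl -mulrA.
by move=> v' c x' y'; rewrite linearP mulrDr mulrCA.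
Qed.
HB.instance Definition _ :=
  GRing.isMonoidMorphism.Build (measures H) (measures G) incl
    incl_is_monoid_morphism.

End Inclusion.

(* G(R) is the set of k-algebra homomorphisms k[G] -> R; [point_mul] is its   *)
(* group law.                                                                 *)
Notation points G R := {lrmorphism coordRing G -> R}.

Definition point_mul (k : fieldType) (G : finGroupScheme k) (R : comAlgType k)
    (g h : coordRing G -> R) (a : coordRing G) : R :=
  tlift (fun x y => g x * h y) (comul G a).

Definition abelian_scheme (k : fieldType) (G : finGroupScheme k) : Prop :=
  forall (R : comAlgType k) (g h : points G R),
    point_mul g h =1 point_mul h g.

(* Z is the centre of G: for every commutative k-algebra R, the subgroup Z(R) *)
(* of G(R) consists of the g in G(R) that commute with G(S) for every         *)
(* R-algebra S.                                                               *)
Definition is_center (k : fieldType) (G : finGroupScheme k)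
    (Z : subgroupScheme G) : Prop :=
  forall (R : comAlgType k) (g : points G R),
    (exists z : points Z R, g =1 z \o restr Z) <->
    (forall (S : comAlgType k) (f : {lrmorphism R -> S}) (h : points G S),
       point_mul (f \o g) h =1 point_mul h (f \o g)).

(* Finite-dimensional left modules over a k-algebra; [act M u] is u_M.        *)
Record fdModule (k : fieldType) (B : algType k) := FdModule {
  fdSpace :> vectType k;
  act : {linear B -> 'End(fdSpace)};
  act1 : act 1 = \1%VF;
  actM : forall u v : B, act (u * v) = (act u \o act v)%VF
}.

(* Every nonzero module has a nonzero fixed vector; u |-> u(1) is the counit  *)
(* of kG.                                                                     *)
Definition unipotent (k : fieldType) (G : finGroupScheme k) : Prop :=
  forall M : fdModule (measures G), (exists m : M, m != 0) ->
  exists2 m : M, m != 0 &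
    forall u : measures G, act M u m = (meas_fun u 1 : k) *: m.

Section Pullback.

Variables (k : fieldType) (B C : algType k) (f : {lrmorphism B -> C}).
Variable M : fdModule C.

Fact pull_act1 : (act M \o f) 1 = \1%VF.
Proof. by rewrite /= rmorph1 act1. Qed.

Fact pull_actM u v :
  (act M \o f) (u * v) = (act M (f u) \o act M (f v))%VF.
Proof. by rewrite /= rmorphM actM. Qed.

Definition pull : fdModule B := FdModule pull_act1 pull_actM.

End Pullback.

Definition restrict (k : fieldType) (G : finGroupScheme k)
    (H : subgroupScheme G) (M : fdModule (measures G)) : fdModule (measures H) :=
  pull (@incl k G H) M.

Section Regular.

Variables (k : fieldType) (B : falgType k).

Fact regular_act1 : amull (1 : B) = \1%VF.
Proof. exact: amull1. Qed.

Fact regular_actM (u v : B) : amull (u * v) = (amull u \o amull v)%VF.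
Proof. by apply/lfunP => w; rewrite !lfunE /= !lfunE /= mulrA. Qed.

Definition regular : fdModule B := FdModule regular_act1 regular_actM.

End Regular.

Definition projective (R : nzRingType) (P : lmodType R) : Prop :=
  forall (M N : lmodType R) (g : {linear M -> N}) (f : {linear P -> N}),
    (forall y, exists x, g x = y) ->
    exists h : {linear P -> M}, forall x, g (h x) = f x.

(* M as an lmodType over the ring B.                                          *)
Definition lmod_of (k : fieldType) (B : algType k) (M : fdModule B) : Type := M.

Section LmodOf.

Variables (k : fieldType) (B : algType k) (M : fdModule B).

HB.instance Definition _ := GRing.Zmodule.copy (lmod_of M) (fdSpace M).

Definition lmod_scale (u : B) (m : lmod_of M) : lmod_of M := act M u m.

Fact lmod_scaleA u v m :
  lmod_scale u (lmod_scale v m) = lmod_scale (u * v) m.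
Proof. by rewrite /lmod_scale actM lfunE. Qed.

Fact lmod_scale1 : left_id 1 lmod_scale.
Proof. by move=> m; rewrite /lmod_scale act1 lfunE. Qed.

Fact lmod_scaleDr : right_distributive lmod_scale +%R.
Proof. by move=> u m n; rewrite /lmod_scale; apply: linearD. Qed.

Fact lmod_scaleDl m : {morph lmod_scale^~ m : u v / u + v}.
Proof. by move=> u v; rewrite /lmod_scale linearD add_lfunE. Qed.

HB.instance Definition _ := GRing.Zmodule_isLmodule.Build B (lmod_of M)
  lmod_scaleA lmod_scale1 lmod_scaleDr lmod_scaleDl.

End LmodOf.

(* k[T]/(T^p), with t the class of T.                                         *)
Notation Ap k p := {poly %/ ('X^p : {poly k})}.
Definition Ap_t (k : fieldType) (p : nat) : Ap k p := 'qX.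

Section PPoints.

Variables (k : fieldType) (p : nat).

Record ppoint (G : finGroupScheme k) := PPoint {
  ppmap :> {lrmorphism Ap k p -> measures G};
  ppoint_proj : projective (lmod_of (pull ppmap (regular (measures G))));
  ppoint_abelian_unipotent : exists U : subgroupScheme G,
    [/\ abelian_scheme U, unipotent U &
        forall a, exists u : measures U, ppmap a = incl u]
}.

Definition pp_op (G : finGroupScheme k) (M : fdModule (measures G))
    (alpha : ppoint G) : 'End(M) := act M (alpha (Ap_t k p)).

Definition constant_rank (G : finGroupScheme k) (M : fdModule (measures G)) :=
  forall alpha beta : ppoint G,
    \dim (limg (pp_op M alpha)) = \dim (limg (pp_op M beta)).

Definition lfun_pow (V : vectType k) (f : 'End(V)) (n : nat) : 'End(V) :=
  iter n (comp_lfun f) \1%VF.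

Definition equal_images (G : finGroupScheme k) (M : fdModule (measures G)) :=
  forall l : nat, (1 <= l <= p.-1)%N ->
  exists V : {vspace M}, forall alpha : ppoint G,
    limg (lfun_pow (pp_op M alpha) l) = V.

Definition pp_equiv (G : finGroupScheme k) (alpha beta : ppoint G) : Prop :=
  forall N : fdModule (measures G),
    projective (lmod_of (pull alpha N)) <-> projective (lmod_of (pull beta N)).

(* The space P(G); its points are the equivalence classes of p-points.        *)
Definition Pspace (G : finGroupScheme k) : Type :=
  {c : set (ppoint G) |
    exists alpha, c = [set beta | pp_equiv alpha beta]%classic}.

Definition Psupport (G : finGroupScheme k) (N : fdModule (measures G)) :
    set (Pspace G) :=
  [set c | exists2 alpha : ppoint G, sval c alpha
                                    & ~ projective (lmod_of (pull alpha N))]%classic.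

Definition Pclosed (G : finGroupScheme k) : set (set (Pspace G)) :=
  [set S | exists N, S = @Psupport G N]%classic.

End PPoints.

Definition is_max (S : set nat) (m : nat) : Prop :=
  S m /\ forall n, S n -> (n <= m)%N.

Section Dimension.

Local Open Scope classical_set_scope.

Variables (T : Type) (closed : set (set T)).

Definition irreducible_closed (Z : set T) : Prop :=
  [/\ closed Z, Z !=set0 &
    forall A B, closed A -> closed B -> Z `<=` A `|` B -> Z `<=` A \/ Z `<=` B].

Definition irreducible_chain (n : nat) (Z : nat -> set T) : Prop :=
  (forall i, (i < n)%N -> irreducible_closed (Z i)) /\
  (forall i, (i.+1 < n)%N -> Z i `<` Z i.+1).

(* A chain of length d has d + 1 members; in particular dim set0 = -1.        *)
Definition has_dim (d : int) : Prop :=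
  exists2 m, is_max [set n | exists Z, irreducible_chain n Z] m
           & d = m%:Z - 1.

End Dimension.

(* rk_au(G) = r.                                                              *)
Definition has_rk_au (k : fieldType) (p : nat) (G : finGroupScheme k)
    (r : nat) : Prop :=
  is_max [set n | exists U : subgroupScheme G,
    [/\ abelian_scheme U, unipotent U &
        has_dim (@Pclosed k p U) (n%:Z - 1)]]%classic r.

(* Main.v *)
Require Import Defs.
From HB Require Import structures.
From mathcomp Require Import all_boot all_order all_algebra all_field.
From mathcomp Require Import boolp classical_sets ring.

(** Let V be the common image of the p-points of the centre Z on M. A central
    abelian unipotent subgroup U with rk_au >= 2 supplies b1, b2 in kU such that
    every nonzero combination b = s b1 + t b2 is a p-point, both of Z and of G.
    If a comes from a p-point of G, then b and a lie in kW for an abelian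
    unipotent subgroup W, so b + u a is a p-point for all but finitely many
    scalars u. Constant rank then forces a to map ker b into im b = V. The
    kernels of the members of a pencil of surjections onto V span M, hence
    a M = V, and a^l M = b^l M follows because a and b commute.

    To find b1 and b2, put R = kU, a commutative local algebra. If its maximal
    ideal m needed only one generator, R would be a chain ring and all p-points
    of U would be equivalent. So dim m/m^2 >= 2, and derivations of R given by
    primitive functions together with the freeness of measure algebras over
    those of unipotent subgroups produce the pencil. *)

Set Implicit Arguments.
Unset Strict Implicit.
Unset Printing Implicit Defensive.
Import GRing.Theory.
Local Open Scope ring_scope.

(** * Nilpotent operators and generic rank *)

(** Projectivity over k[T]/(T^p) is handled as [exactp]: ker f = im f^(p-1), equivalently p dim ker
    f <= dim V when f^p = 0. The second form is an open condition along a line, which is why b + u a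
    stays a p-point for almost all u.

    Two generators x, y of m do not themselves span a pencil of p-points, because their p-th powers
    may be nonzero. Hence a power x^N and a corrected y are used. A derivation D with D x a unit
    cancels x from x^n f = 0 only if p does not divide n; at the multiples of p, freeness over the
    algebra of p-th powers takes over.

    Subgroups are found on the measure side: a sub-bialgebra S of kG is given, and k[G] modulo the
    annihilator of S is shown to be a Hopf algebra. This produces both the subgroup W and the
    subgroup whose measures are the p-th powers in kU.

    The rank hypothesis enters through two inequivalent p-points of U. The constant rank of M
    concerns only the first power of t; higher powers are reached because a commutes with the
    central b. *)

Section LinearAlgebra.
Import passmx.
Variable k : fieldType.

Section MkLfun.
Variables (V W : vectType k) (f : V -> W) (lf : linear f).
Let L := GRing.isLinear.Build k V W _ f lf.
Let fL : {linear V -> W} := HB.pack f L.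
Definition mklfun : 'Hom(V, W) := locked (linfun fL).
Lemma mklfunE x : mklfun x = f x. Proof. by rewrite /mklfun -lock lfunE. Qed.
End MkLfun.

(** Turns a linear condition stated in [Prop] into a subspace: a subspace of largest dimension
    inside [P] absorbs every vector of [P]. *)
Lemma ex_vspace (V : vectType k) (P : V -> Prop) :
  P 0 -> (forall c x y, P x -> P y -> P (c *: x + y)) ->
  exists U : {vspace V}, forall x, x \in U <-> P x.
Proof.
move=> P0 PD; pose Q n := `[< exists2 U : {vspace V}, \dim U = n &
  forall x, x \in U -> P x >].
have exQ : exists n, Q n.
  by exists 0%N; apply/asboolP; exists 0%VS; rewrite ?dimv0 // => x; rewrite memv0 => /eqP->.
have leQ n : Q n -> (n <= \dim {:V})%N.
  by move=> /asboolP[U <- _]; rewrite dimvS ?subvf.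
case: (ex_maxnP exQ leQ) => n /asboolP[U dU UP] maxn.
exists U => x; split=> [/UP//|Px].
have UxP y : y \in (U + <[x]>)%VS -> P y.
  move=> /memv_addP[u /UP Pu [_ /vlineP[c ->] ->]].
  by rewrite addrC; apply: PD.
have : (\dim (U + <[x]>)%VS <= \dim U)%N.
  by rewrite dU; apply: maxn; apply/asboolP; exists (U + <[x]>)%VS.
move=> h.
have : (\dim U == \dim (U + <[x]>)%VS)%N by rewrite eqn_leq dimvS ?addvSl.
by rewrite dimv_leqif_eq ?addvSl // => /eqP->; rewrite (subvP (addvSr _ _)) ?memv_line.
Qed.

Lemma ex_min_vspace (V : vectType k) (P : {vspace V} -> Prop) U0 :
  P U0 -> exists2 U, P U & forall W, P W -> (\dim U <= \dim W)%N.
Proof.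
move=> PU0; pose Q n := `[< exists2 U : {vspace V}, \dim U = n & P U >].
have exQ : exists n, Q n by exists (\dim U0); apply/asboolP; exists U0.
case: (ex_minnP exQ) => n /asboolP[U dU PU] minn; exists U => // W PW.
by rewrite dU; apply: minn; apply/asboolP; exists W.
Qed.

Lemma separate (V : vectType k) (U : {vspace V}) (x : V) :
  x \notin U -> exists2 f : 'Hom(V, k^o), f x = 1 & forall u, u \in U -> f u = 0.
Proof.
move=> xU; pose X := [tuple of x :: vbasis U].
have Xf : free X.
  by rewrite /= free_cons (span_basis (vbasisP U)) xU (basis_free (vbasisP U)).
exists (linfun (coord X ord0 : V -> k^o)) => [|u uU]; rewrite lfunE /=.
  by rewrite (_ : x = X`_(@ord0 (\dim U))) // coord_free.
rewrite (coord_vbasis uU) linear_sum big1 // => i _; rewrite linearZ /=.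
rewrite (_ : (vbasis U)`_i = X`_(lift ord0 i)) //.
rewrite coord_free // (_ : (_ == _) = false) ?mulr0 //.
Qed.

Lemma lfun_eigen_root (V : vectType k) (f : 'End(V)) a :
  (exists2 x, f x = a *: x & x != 0) <->
  root (char_poly (mxof (vbasis {:V}) (vbasis {:V}) f)) a.
Proof.
have b := vbasisP {:V}; rewrite -eigenvalue_root_char; split.
  move=> [x fx x0]; apply/eigenvalueP; exists (rVof (vbasis {:V}) x).
    by rewrite -rVof_app // fx linearZ.
  by rewrite rVof_eq0.
move/eigenvalueP=> [v vE v0]; exists (vecof (vbasis {:V}) v).
  by rewrite (hom_vecof (vbasis {:V}) b) vE linearZ.
by rewrite vecof_eq0.
Qed.

Section NilpotentOperator.
Variables (V : vectType k) (f : 'End(V)) (p : nat).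
Hypotheses (p_gt0 : (0 < p)%N) (fp : forall x, iter p f x = 0).

(** Together with f^p = 0 this says that all Jordan blocks of [f] have size [p]: V is free over
    k[T]/(T^p), with T acting as [f]. *)
Definition exactp := forall x, f x = 0 -> exists y, x = iter p.-1 f y.

Let W i : {vspace V} := iter i (lfun_img f) {:V}%VS.

Let memW i x : reflect (exists y, x = iter i f y) (x \in W i).
Proof.
apply: (iffP idP).
  elim: i x => [|i IH] x; first by exists x.
  by move=> /memv_imgP[y /IH[z ->] ->]; exists z.
by move=> [y ->]; elim: i => [|i IH]; [apply: memvf | apply: memv_img].
Qed.

(** The number of Jordan blocks of [f] of size greater than [i]. *)
Let d i := \dim (W i :&: lker f).

Let dW i : \dim (W i) = (d i + \dim (W i.+1))%N.
Proof. by rewrite limg_ker_dim. Qed.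

Let sumd : \dim {:V} = (\sum_(i < p) d i)%N.
Proof.
have : W p = 0%VS.
  by apply/eqP; rewrite -subv0; apply/subvP => x /memW[y ->]; rewrite fp mem0v.
have : \dim {:V} = ((\sum_(i < p) d i) + \dim (W p))%N.
  elim: (p) => [|n IH]; first by rewrite big_ord0.
  by rewrite big_ord_recr /= -addnA -dW.
by move=> -> ->; rewrite dimv0 addn0.
Qed.

Let led i : (d i <= \dim (lker f))%N. Proof. by rewrite dimvS ?capvSr. Qed.

(** dim V is the sum of the [p] numbers [d i], each at most dim ker f. The inequality therefore
    makes all of them maximal, and [d p.-1] is maximal exactly when ker f lies in im f^(p-1). *)
Lemma exactp_dim : exactp <-> (p * \dim (lker f) <= \dim {:V})%N.
Proof.
split=> [ex|le].
  have dE i : (i < p)%N -> d i = \dim (lker f).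
    move=> ip; congr (\dim _); apply/eqP; rewrite eqEsubv capvSr subv_cap subvv andbT.
    apply/subvP => x; rewrite memv_ker => /eqP /ex[y ->]; apply/memW.
    exists (iter (p.-1 - i) f y); rewrite -iterD subnKC //.
    by rewrite -ltnS prednK.
  by rewrite sumd (eq_bigr (fun=> \dim (lker f))) ?sum_nat_const ?card_ord // => i _; apply: dE.
have lt : (p.-1 < p)%N by rewrite prednK.
suff : (lker f <= W p.-1)%VS.
  by move=> /subvP sub x fx; apply/memW/sub; rewrite memv_ker fx.
have : (\dim (lker f) <= d p.-1)%N.
  rewrite leqNgt; apply: contraTN le => dlt; rewrite -ltnNge sumd.
  rewrite (bigD1 (Ordinal lt)) //= -[in X in (_ < X)%N](prednK p_gt0) mulSn -addSn.
  apply: leq_add => //; move: (Ordinal lt) => j; rewrite -[p in (_ <= p.-1 * _)%N]card_ord -(cardC1 j).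
  by rewrite -sum_nat_const; apply: leq_sum => i _; apply: led.
move=> h; have : (\dim (W p.-1 :&: lker f) == \dim (lker f))%N by rewrite eqn_leq led.
by rewrite dimv_leqif_eq ?capvSr // => /eqP <-; apply: capvSl.
Qed.

Lemma lfun_powE n x : lfun_pow f n x = iter n f x.
Proof. by elim: n => [|n IH] /=; rewrite ?id_lfunE // comp_lfunE IH. Qed.

Lemma iterB n x y : iter n f (x - y) = iter n f x - iter n f y.
Proof. by rewrite -!lfun_powE linearB. Qed.

Lemma exactp_iter n x : exactp -> (n < p)%N -> iter n f x = 0 -> exists y, x = f y.
Proof.
move=> ex; elim: n x => [|n IH] x np; first by move=> /= ->; exists 0; rewrite linear0.
move=> /= /ex[y yE].
have nE : (p.-1 = n + (p.-1 - n.+1).+1)%N.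
  by rewrite -subSn ?subSS ?subnKC // -ltnS prednK // ltnW.
have [|z zE] := IH (x - iter (p.-1 - n.+1).+1 f y) (ltnW np).
  by rewrite iterB -iterD -nE yE subrr.
exists (z + iter (p.-1 - n.+1) f y); rewrite linearD /= -zE.
by rewrite subrK.
Qed.

(* The operator sum_i f^i h f^(p-1-i) commutes with f, and for h a partial    *)
(* inverse of f^(p-1) it is unipotent for the filtration by images of powers. *)
Lemma exactp_trace : exactp -> exists h : 'End(V), forall x,
  \sum_(i < p) iter i f (h (iter (p.-1 - i) f x)) = x.
Proof.
move=> ex; pose g := lfun_pow f p.-1; pose h := (g^-1)%VF.
pose T := \sum_(i < p) (lfun_pow f i \o h \o lfun_pow f (p.-1 - i))%VF.
have TE x : T x = \sum_(i < p) iter i f (h (iter (p.-1 - i) f x)).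
  by rewrite sum_lfunE; apply: eq_bigr => i _; rewrite !comp_lfunE !lfun_powE.
have Tf x : T (f x) = f (T x).
  rewrite !TE; case: (p) p_gt0 fp => // q _ fq.
  rewrite linear_sum big_ord_recl [RHS]big_ord_recr /= subn0 -iterSr fq linear0.
  rewrite -[f (iter q f _)]/(iter q.+1 f _) fq add0r addr0; apply: eq_bigr => i _.
  by rewrite -iterSr /bump leq0n add1n -subSn // subSS.
have Tfn n x : T (iter n f x) = iter n f (T x).
  by elim: n => //= n <-; rewrite Tf.
have T1 y : exists z, T y - y = f z.
  have [z zE] : exists z, h (g y) - y = f z.
    apply: (@exactp_iter p.-1 _ ex); first by rewrite prednK.
    rewrite iterB -2!lfun_powE -[X in X - _]/(g (h (g y))).
    by rewrite limg_lfunVK ?memv_img ?memvf // /g subrr.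
  rewrite TE (bigD1 (Ordinal p_gt0)) //= subn0 -lfun_powE -/g addrAC zE.
  exists (z + \sum_(i < p | i != Ordinal p_gt0) iter i.-1 f (h (iter (p.-1 - i) f y))).
  rewrite linearD linear_sum; congr (_ + _); apply: eq_bigr => -[[|i] ip] //.
(* [T] commutes with [f] and is the identity modulo im f, so a vector of im f^n killed by [T] lies
   in im f^(n+1), and finally in im f^p = 0. *)
have Tinj : lker T == 0%VS.
  rewrite -subv0; apply/subvP => x; rewrite memv_ker memv0 => /eqP Tx.
  suff [y ->] : exists y, x = iter p f y by rewrite fp.
  elim: (p) => [|n [y xE]]; first by exists x.
  have [z zE] := T1 y; exists (- z); rewrite iterSr linearN /= -zE opprB iterB -xE.
  by rewrite -Tfn -xE Tx subr0.
have Tifn n x : (T^-1)%VF (iter n f x) = iter n f ((T^-1)%VF x).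
  by apply: (lker0P Tinj); rewrite Tfn !lker0_lfunVK.
exists (h \o T^-1)%VF => x; rewrite -[RHS](lker0_lfunVK Tinj) TE.
by apply: eq_bigr => i _; rewrite comp_lfunE Tifn.
Qed.
End NilpotentOperator.

Definition cofin (P : k -> Prop) := exists s : seq k, forall u, u \notin s -> P u.

Lemma cofinI P Q : cofin P -> cofin Q -> cofin (fun u => P u /\ Q u).
Proof.
move=> [s sP] [t tQ]; exists (s ++ t) => u; rewrite mem_cat negb_or => /andP[us ut].
by split; [apply: sP | apply: tQ].
Qed.

End LinearAlgebra.

(** * Generic perturbations and pencils of linear maps *)

Section ClosedField.
Import passmx.
Variable k : closedFieldType.

Lemma cofin_ex (P : k -> Prop) : cofin P -> exists u, P u.
Proof.
move=> [s sP]; have nz : \prod_(z <- s) ('X - z%:P) != 0 :> {poly k}.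
  by rewrite monic_neq0 // monic_prod_XsubC.
have [u] := closed_nonrootP _ nz; rewrite root_prod_XsubC => /sP; by exists u.
Qed.

Lemma lfun_eigen_finite (V : vectType k) (f : 'End(V)) :
  exists s : seq k, forall a x, f x = a *: x -> x != 0 -> a \in s.
Proof.
have [s sE] := closed_field_poly_normal (char_poly (mxof (vbasis {:V}) (vbasis {:V}) f)).
exists s => a x fx x0; have /lfun_eigen_root : exists2 x, f x = a *: x & x != 0 by exists x.
rewrite sE rootZ ?root_prod_XsubC // lead_coef_eq0 monic_neq0 //.
exact: char_poly_monic.
Qed.

Lemma lfun_eigen_exists (V : vectType k) (f : 'End(V)) (E : {vspace V}) :
  E != 0%VS -> (forall x, x \in E -> f x \in E) ->
  exists a x, [/\ x \in E, x != 0 & f x = a *: x].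
Proof.
move=> E0 fE; pose g := linfun (vsproj E \o f \o vsval) : 'End(subvs_of E).
have [|a] := closed_rootP (char_poly (mxof (vbasis {:subvs_of E}) (vbasis {:subvs_of E}) g)) _.
  by rewrite size_char_poly eqSS dimvf /dim /= dimv_eq0.
move=> /lfun_eigen_root[x gx x0]; exists a, (vsval x); split.
- exact: subvsP.
- by rewrite -(inj_eq val_inj) in x0.
by move: gx => /(congr1 vsval); rewrite lfunE /= vsprojK ?fE ?subvsP.
Qed.

Lemma cofin_inj1 (V : vectType k) (N : 'End(V)) :
  cofin (fun u : k => lker (\1%VF + u *: N) == 0%VS).
Proof.
have [s sP] := lfun_eigen_finite N; exists [seq - a^-1 | a <- s] => u us.
rewrite -subv0; apply/subvP => x; rewrite memv_ker memv0.
rewrite add_lfunE scale_lfunE id_lfunE addr_eq0 => /eqP xE.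
apply: contraNT us => x0; have u0 : u != 0.
  by apply: contraNneq x0 => u0; rewrite xE u0 scale0r oppr0.
apply/mapP; exists (- u^-1); last by rewrite invrN opprK invrK.
apply: (sP _ x) => //; rewrite {2}xE scaleNr scalerN opprK scalerA mulVf //.
by rewrite scale1r.
Qed.

(** Composed with the partial inverse of [f], the map f + u g becomes 1 + u g f^-1 on im f, which is
    injective for generic u. *)
Lemma cofin_rank (V : vectType k) (f g : 'End(V)) :
  cofin (fun u : k => \dim (limg f) <= \dim (limg (f + u *: g)%R))%N.
Proof.
have [s sP] := cofin_inj1 (g \o f^-1)%VF; exists s => u /sP inj.
rewrite -(limg_dim_eq (f := \1%VF + u *: (g \o f^-1)%VF)); last first.
  by rewrite (eqP inj) capv0.
apply: dimvS; apply/subvP => _ /memv_imgP[x xf ->].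
rewrite add_lfunE scale_lfunE id_lfunE comp_lfunE -{1}(limg_lfunVK xf).
by rewrite -scale_lfunE -add_lfunE memv_img ?memvf.
Qed.

Lemma cofin_exactp (V : vectType k) (f g : 'End(V)) p : (0 < p)%N ->
  (forall x, iter p f x = 0) ->
  (forall u x, iter p (f + u *: g) x = 0) ->
  exactp f p -> cofin (fun u : k => exactp (f + u *: g) p).
Proof.
move=> p0 fp fgp; rewrite exactp_dim // => le.
have [s sP] := cofin_rank f g; exists s => u /sP rk; apply/exactp_dim => //.
apply: leq_trans le; rewrite leq_mul2l; apply/orP; right.
have := limg_ker_dim f {:V}; have := limg_ker_dim (f + u *: g) {:V}.
rewrite !capfv => <- /eqP; rewrite -(leq_add2r (\dim (limg f))) => /eqP ->.
by rewrite leq_add2l.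
Qed.

(** Since (c + u a) m = u (a m), the vector a m lies in im (c + u a) for every u != 0. If it were
    outside im c, the rank would have to grow. *)
Lemma limg_first_order (V : vectType k) (c a : 'End(V)) m :
  cofin (fun u : k => \dim (limg (c + u *: a)%R) <= \dim (limg c))%N ->
  c m = 0 -> a m \in limg c.
Proof.
move=> le cm; apply/negPn/negP => am.
have m0 : m != 0 by apply: contraNneq am => ->; rewrite linear0 mem0v.
have [chi chim chiU] : exists2 f : 'Hom(V, k^o), f m = 1 & forall u, u \in ((lker c)^C)%VS -> f u = 0.
  apply: separate; apply: contraNN m0 => mC; rewrite -memv0 -(capv_compl (lker c)).
  by rewrite memv_cap mC andbT memv_ker cm.
pose P : 'End(V) := \1%VF - projv (lker c).
have PC x : P x \in ((lker c)^C)%VS by rewrite add_lfunE opp_lfunE id_lfunE memv_projC.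
have cP x : c (P x) = c x.
  rewrite add_lfunE opp_lfunE id_lfunE linearB /=.
  by rewrite (eqP (_ : c (projv _ _) == 0)) ?subr0 // -memv_ker memv_proj.
have rlin : linear (fun x => chi x *: a m).
  by move=> e x y; rewrite linearP scalerDl -scalerA.
pose r := mklfun rlin.
(* [Q0 + u Q1] is (c + u a) P plus a rank-one map with values in the line of a m, so for u != 0 its
   image lies in im (c + u a). At u = 0 the image already contains im c and a m. *)
pose Q0 := (c \o P)%VF + r; pose Q1 := (a \o P)%VF.
have sub u : u != 0 -> (limg (Q0 + u *: Q1)%R <= limg (c + u *: a)%R)%VS.
  move=> u0; apply/subvP => _ /memv_imgP[x _ ->].
  rewrite /Q0 /Q1 !add_lfunE scale_lfunE !comp_lfunE mklfunE addrAC.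
  rewrite -scale_lfunE -add_lfunE memvD ?memv_img ?memvf //.
  rewrite memvZ // -[a m](scalerK u0) memvZ //.
  by rewrite -[u *: a m]add0r -cm -scale_lfunE -add_lfunE memv_img ?memvf.
have rk : (\dim (limg c) < \dim (limg Q0))%N.
  have : (limg c + <[a m]> <= limg Q0)%VS.
    rewrite subv_add -memvE; apply/andP; split; last first.
      apply/memv_imgP; exists m; rewrite ?memvf // /Q0 add_lfunE comp_lfunE mklfunE chim.
      by rewrite scale1r cP cm add0r.
    apply/subvP => _ /memv_imgP[x _ ->]; apply/memv_imgP.
    exists (P x); rewrite ?memvf // /Q0 add_lfunE comp_lfunE mklfunE chiU //.
    by rewrite scale0r addr0 !cP.
  move=> /dimvS; apply: leq_trans; rewrite ltn_neqAle dimvS ?addvSl // andbT.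
  rewrite dimv_leqif_eq ?addvSl //; apply: contraNneq am => ->.
  by rewrite (subvP (addvSr _ _)) ?memv_line.
have [u [[le1 le2] u0]] : exists u : k, (\dim (limg (c + u *: a)%R) <= \dim (limg c) /\
    \dim (limg Q0) <= \dim (limg (Q0 + u *: Q1)%R))%N /\ u != 0.
  apply: cofin_ex; apply: cofinI; last by exists [:: 0] => u; rewrite inE.
  by apply: cofinI => //; apply: cofin_rank.
by have := leq_trans le2 (leq_trans (dimvS (sub u u0)) le1); rewrite leqNgt rk.
Qed.

(* Let y_l solve b1 y + l b2 y = g and E be their span. If g is not in b2(E), *)
(* y |-> b2^-1(chi(b1 y) g - b1 y) has every scalar l as eigenvalue;          *)
(* otherwise b2^-1 b1 preserves E and an eigenvector is killed by a member of *)
(* the pencil.                                                                *)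
Lemma injective_pencil_capI (Y X : vectType k) (b1 b2 : 'Hom(Y, X)) (g : X) :
  (forall s t y, (s != 0) || (t != 0) -> s *: b1 y + t *: b2 y = 0 -> y = 0) ->
  (forall l, exists y, b1 y + l *: b2 y = g) -> g = 0.
Proof.
move=> inj ex; apply/eqP/negPn/negP => g0.
have [y yE] : {y : k -> Y | forall l, b1 (y l) + l *: b2 (y l) = g}.
  by exists (fun l => sval (cid (ex l))) => l; case: cid.
have y0 l : y l != 0.
  by apply: contraNneq g0 => yl; rewrite -(yE l) yl !linear0 ?scaler0 addr0.
have b2inj : lker b2 == 0%VS.
  rewrite -subv0; apply/subvP => x; rewrite memv_ker memv0 => /eqP b2x.
  apply/eqP/(inj 0 1); first by rewrite oner_eq0 orbT.
  by rewrite scale0r b2x scaler0 addr0.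
have [|E yE' Emin] := @ex_min_vspace k Y (fun E => forall l, y l \in E) {:Y}%VS.
  by move=> l; apply: memvf.
have {}Emin (W : {vspace Y}) : (forall l, y l \in W) -> (E <= W)%VS.
  move=> yW; have : (\dim E == \dim (E :&: W))%N.
    rewrite eqn_leq Emin ?dimvS ?capvSl // => l; by rewrite memv_cap yE' yW.
  by rewrite eq_sym dimv_leqif_eq ?capvSl // => /eqP <-; rewrite capvSr.
have [gE|gE] := boolP (g \in (b2 @: E)%VS).
  pose f := (b2^-1 \o b1)%VF.
  have b2f x : x \in E -> f x \in E /\ b2 (f x) = b1 x.
    move=> xE; have : x \in (b1 @^-1: (b2 @: E))%VS.
      apply: (subvP (Emin _ _)) xE => l; rewrite -memv_preim.
      rewrite (_ : b1 _ = g - l *: b2 (y l)) ?rpredB ?rpredZ ?memv_img //.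
      by rewrite -(yE l) addrK.
    rewrite -memv_preim => /memv_imgP[z zE b1x]; rewrite comp_lfunE b1x.
    by rewrite lker0_lfunK.
  have E0 : E != 0%VS.
    by apply: contraNneq (y0 0) => E0; have := yE' 0; rewrite E0 memv0.
  have [a [x [xE x0 fx]]] := lfun_eigen_exists E0 (fun x xE => (b2f x xE).1).
  move/eqP: x0; apply; apply: (inj 1 (- a)); first by rewrite oner_eq0.
  by rewrite scale1r -(b2f x xE).2 fx linearZ scaleNr subrr.
have [chi chig chiE] := separate gE.
have flin : linear (fun z => (b2^-1)%VF (chi (b1 z) *: g - b1 z)).
  move=> c u v; rewrite -linearP; congr ((b2^-1)%VF _).
  rewrite (linearP b1) (linearP chi) scalerBr scalerDl scalerA opprD.
  by rewrite addrACA.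
have [s sP] := lfun_eigen_finite (mklfun flin).
have [|l lP] := @cofin_ex (fun u => u \notin s); first by exists s.
move/negP: lP; apply; apply: (sP l (y l)) => //; rewrite mklfunE.
have b1y : b1 (y l) = g - l *: b2 (y l) by rewrite -(yE l) addrK.
have -> : chi (b1 (y l)) = 1.
  by rewrite b1y linearB linearZ /= chig chiE ?memv_img // scaler0 subr0.
by rewrite scale1r b1y opprB addrCA subrr addr0 linearZ /= lker0_lfunK.
Qed.

(** Let [phi] vanish on V. By [limg_first_order], phi a kills the kernel of every b1 + l b2, hence
    factors through it. Transposition turns the surjections onto V into an injective pencil from V^*
    to M^*, and [injective_pencil_capI] gives phi a = 0. This is the dual form of the statement that
    the kernels span M. *)
Lemma surjective_pencil_image (M : vectType k) (b1 b2 a : 'End(M)) (V : {vspace M}) :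
  (forall s t, (s != 0) || (t != 0) -> limg (s *: b1 + t *: b2) = V) ->
  (forall s t, (s != 0) || (t != 0) ->
     cofin (fun u : k => \dim (limg ((s *: b1 + t *: b2) + u *: a)%R) <= \dim V)%N) ->
  (limg a <= V)%VS.
Proof.
move=> imV rk; apply/subvP => _ /memv_imgP[m _ ->]; apply/negPn/negP => amV.
have [phi phia phiV] := separate amV.
have bV s t x : (s != 0) || (t != 0) -> s *: b1 x + t *: b2 x \in V.
  by move=> st; rewrite -(imV _ _ st) -!scale_lfunE -add_lfunE memv_img ?memvf.
have b1V x : b1 x \in V.
  by have := bV 1 0 x; rewrite scale1r scale0r addr0; apply; rewrite oner_eq0.
have b2V x : b2 x \in V.
  by have := bV 0 1 x; rewrite scale1r scale0r add0r; apply; rewrite oner_eq0 orbT.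
pose B (b : 'End(M)) (psi : 'Hom(subvs_of V, k^o)) : 'Hom(M, k^o) :=
  (psi \o linfun (vsproj V) \o b)%VF.
have BE b psi x : B b psi x = psi (vsproj V (b x)).
  by rewrite !comp_lfunE lfunE.
have Blin b : linear (B b).
  move=> c u v; apply/lfunP => x; rewrite add_lfunE scale_lfunE !BE.
  by rewrite add_lfunE scale_lfunE.
suff: (phi \o a)%VF = 0.
  move=> /(congr1 (fun f : 'Hom(M, k^o) => f m)); rewrite comp_lfunE phia zero_lfunE.
  by move/eqP; rewrite oner_eq0.
apply: (@injective_pencil_capI _ _ (mklfun (Blin b1)) (mklfun (Blin b2))).
  move=> s t psi st; rewrite !mklfunE => psi0; apply/lfunP => v; rewrite zero_lfunE.
  have imP w : w \in V -> exists x, w = (s *: b1 + t *: b2) x.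
    by rewrite -(imV _ _ st) => /memv_imgP[x _ ->]; exists x.
  have [x wE] := imP _ (subvsP v).
  have := congr1 (fun f : 'Hom(M, k^o) => f x) psi0.
  rewrite zero_lfunE add_lfunE !scale_lfunE !BE => <-.
  have -> : v = s *: vsproj V (b1 x) + t *: vsproj V (b2 x).
    by apply: val_inj; rewrite /= !vsprojK // wE add_lfunE !scale_lfunE.
  by rewrite linearD !linearZ.
move=> l; have st : (1 != 0 :> k) || (l != 0) by rewrite oner_eq0.
pose c := b1 + l *: b2; have imc : limg c = V by rewrite -(imV _ _ st) scale1r.
have cker x : c x = 0 -> phi (a x) = 0.
  move=> cx; apply: phiV; rewrite -imc; apply: limg_first_order cx.
  by rewrite imc; have := rk _ _ st; rewrite scale1r.
exists (phi \o a \o c^-1 \o linfun vsval)%VF; apply/lfunP => x.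
rewrite add_lfunE scale_lfunE !mklfunE !BE !comp_lfunE !lfunE /= !vsprojK //.
have -> : l *: phi (a ((c^-1)%VF (b2 x))) = phi (a ((c^-1)%VF (l *: b2 x))).
  by rewrite !linearZ.
rewrite -!linearD /= -scale_lfunE -add_lfunE -/c; apply/eqP; rewrite -subr_eq0 -!linearB /=.
apply/eqP/cker; rewrite linearB /= limg_lfunVK ?subrr //.
by rewrite memv_img ?memvf.
Qed.
End ClosedField.

Lemma ex_max_vspace (k : fieldType) (V : vectType k) (P : {vspace V} -> Prop) U0 :
  P U0 -> exists2 U, P U & forall W, P W -> (\dim W <= \dim U)%N.
Proof.
move=> PU0; pose Q n := `[< exists2 U : {vspace V}, \dim U = n & P U >].
have exQ : exists n, Q n by exists (\dim U0); apply/asboolP; exists U0.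
have leQ n : Q n -> (n <= \dim {:V})%N by move=> /asboolP[U <- _]; rewrite dimvS ?subvf.
case: (ex_maxnP exQ leQ) => n /asboolP[U dU PU] maxn; exists U => // W PW.
by rewrite dU; apply: maxn; apply/asboolP; exists W.
Qed.

Lemma amullE (k : fieldType) (F : falgType k) (x y : F) : amull x y = x * y.
Proof. by rewrite lfunE. Qed.

Lemma iter_amull (k : fieldType) (F : falgType k) (x y : F) n :
  iter n (amull x) y = x ^+ n * y.
Proof. by elim: n => [|n IH]; rewrite ?mul1r //= IH amullE exprS mulrA. Qed.


(** * Projective modules over k[T]/(T^p) *)

(** The reindexing by which a trace sum of terms t^i (...) t^(p-1-i) commutes with t; the two
    boundary terms contain t^p. *)
Lemma big_shift (V : nmodType) (F : nat -> nat -> V) p : (0 < p)%N ->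
  F 0%N p = 0 -> F p 0%N = 0 ->
  \sum_(i < p) F i (p - i)%N = \sum_(i < p) F i.+1 (p.-1 - i)%N.
Proof.
case: p => // p _ F0 Fp; rewrite big_ord_recl [RHS]big_ord_recr /= subn0 subnn.
by rewrite F0 Fp add0r addr0; apply: eq_bigr => i _; rewrite subSS.
Qed.

Section TruncatedPolynomials.
Import Pdiv.CommonRing Pdiv.RingMonic.
Variables (k : fieldType) (p : nat).
Hypothesis p_gt1 : (1 < p)%N.

Let p_gt0 : (0 < p)%N := ltnW p_gt1.
Let h : {poly k} := 'X^p.
Local Notation t := (Ap_t k p).

Let hE : mk_monic h = 'X^p.
Proof. by rewrite /h mk_monic_Xn prednK. Qed.

Let in_val (q : Ap k p) : in_qpoly h q = q.
Proof. by apply: val_inj => /=; rewrite rmodp_small // size_mk_monic. Qed.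

Let tX n : t ^+ n = in_qpoly h 'X^n. Proof. by rewrite rmorphXn. Qed.

Lemma Ap_t_exp : t ^+ p = 0.
Proof. by rewrite tX; apply: val_inj => /=; rewrite -hE rmodpp ?monic_mk_monic. Qed.

Lemma Ap_decomp (q : Ap k p) : q = \sum_(i < size q) (q`_i)%R *: t ^+ i.
Proof.
rewrite -[LHS]in_val -[X in in_qpoly h X]coefK poly_def linear_sum; apply: eq_bigr => i _.
by rewrite linearZ tX.
Qed.

Lemma Ap_exact (q : Ap k p) : t * q = 0 -> exists q', q = t ^+ p.-1 * q'.
Proof.
have tE : t = 'X :> {poly k} by rewrite qpolyXE ?monicXn // size_polyXn.
have [Q QE] : exists Q, Q = q :> {poly k} by exists q.
move/(congr1 val); rewrite [LHS]poly_of_qpolyM tE -QE /= hE => /eqP.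
rewrite -/(rdvdp _ _) -dvdpE.
have Xp : ('X^p = 'X * 'X^(p.-1) :> {poly k})%R by rewrite -exprS prednK.
rewrite [X in dvdp X _]Xp dvdp_mul2l ?polyX_eq0 // => /dvdpP[r rE].
by exists (in_qpoly h r); rewrite tX -rmorphM /= mulrC -rE QE in_val.
Qed.

Lemma ex_Ap_morph (C : algType k) (w : C) : w ^+ p = 0 ->
  exists f : {lrmorphism Ap k p -> C}, f t = w /\
    forall q : Ap k p, f q = \sum_(i < size q) (q`_i)%R *: w ^+ i.
Proof.
move=> wp; pose e : {rmorphism {poly k} -> C} := horner_alg w.
have eX : e 'X^p = 0 by rewrite rmorphXn /= horner_algX.
have e_mod (q : {poly k}) : e (rmodp q (mk_monic h)) = e q.
  rewrite [q in RHS](rdivp_eq (monic_mk_monic h)) rmorphD rmorphM /=.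
  by rewrite hE eX mulr0 add0r.
pose f (q : Ap k p) : C := e (val q).
have flin : linear f by move=> c x y; rewrite /f /= -mul_polyC rmorphD rmorphM /= horner_algC mulr_algl.
have fmul : monoid_morphism f.
  split=> [|x y]; first by rewrite /f /= rmorph1.
  by rewrite /f [X in e X]poly_of_qpolyM e_mod rmorphM.
pose F : {lrmorphism Ap k p -> C} := HB.pack f
  (GRing.isLinear.Build k (Ap k p) C _ f flin)
  (GRing.isMonoidMorphism.Build (Ap k p) C f fmul).
have Ft : F t = w by rewrite /= /f /= e_mod /= horner_algX.
exists F; split=> // q; rewrite {1}(Ap_decomp q) linear_sum; apply: eq_bigr => i _.
by rewrite linearZ; congr (_ *: _); rewrite [LHS](rmorphXn F); congr (_ ^+ _).
Qed.

Section Modules.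
Variable P : fdModule (Ap k p).
Local Notation T := (act P t).

Let actX n : forall x, act P (t ^+ n) x = iter n T x.
Proof.
elim: n => [|n IH] x; first by rewrite expr0 act1 id_lfunE.
by rewrite exprS actM comp_lfunE IH.
Qed.

Lemma act_iter_p x : iter p T x = 0.
Proof. by rewrite -actX Ap_t_exp linear0 zero_lfunE. Qed.

(** A projective module is a summand of a free one, where [Ap_exact] gives ker t = im t^(p-1); the
    splitting [s] carries this over to P. *)
Lemma projective_exactp : projective (lmod_of P) -> exactp T p.
Proof.
move=> projP; pose d := \dim {:fdSpace P}; pose e := vbasis {:fdSpace P}.
pose f (X : 'rV[Ap k p]_d) : lmod_of P := \sum_i X 0 i *: (e`_i : lmod_of P).
have flin : linear f.
  move=> c X Y; rewrite /f scaler_sumr -big_split; apply: eq_bigr => i _.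
  by rewrite !mxE scalerDl scalerA.
pose F : {linear 'rV[Ap k p]_d -> lmod_of P} := HB.pack f
  (GRing.isLinear.Build (Ap k p) _ _ _ f flin).
have Fsurj y : exists x, F x = y.
  exists (\row_i (coord e i (y : fdSpace P))%:A); rewrite [RHS](coord_vbasis (memvf (y : fdSpace P))).
  apply: eq_bigr => i _; rewrite mxE; rewrite -[LHS]/(act P _ _).
  by rewrite linearZ /= scale_lfunE act1 id_lfunE.
have [s sP] := projP _ _ F (idfun : {linear lmod_of P -> lmod_of P}) Fsurj.
move=> x Tx; have tsx : t *: s x = 0.
  by rewrite -linearZ /= (_ : t *: (x : lmod_of P) = 0) ?linear0.
have ex i : exists q, s x 0 i = t ^+ p.-1 * q.
  by apply: Ap_exact; move/matrixP/(_ 0 i): tsx; rewrite !mxE.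
exists (F (\row_i sval (cid (ex i)))).
rewrite -actX -[RHS]/(t ^+ p.-1 *: F _) -linearZ /= -[LHS](sP (x : lmod_of P)).
congr (f _); apply/rowP => i; rewrite !mxE; by case: cid.
Qed.

(** A k-linear lift [l0] is averaged to the t-linear map [l]. The operator [H] from [exactp_trace]
    acts as an element of trace one, so that [l] is still a lift. *)
Lemma exactp_projective : exactp T p -> projective (lmod_of P).
Proof.
move=> ex; have [H HE] := exactp_trace p_gt0 act_iter_p ex.
move=> M N g f gsurj; pose e := vbasis {:fdSpace P}.
have /choice[m mE] : forall i : 'I_(\dim {:fdSpace P}), exists x, g x = f (e`_i : lmod_of P).
  by move=> i; apply: gsurj.
pose l0 (x : fdSpace P) : M := \sum_i (coord e i x)%:A *: m i.
have l0D x y : l0 (x + y) = l0 x + l0 y.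
  rewrite /l0 -big_split; apply: eq_bigr => i _.
  by rewrite linearD scalerDl scalerDl.
have l0Z c x : l0 (c *: x) = c%:A *: l0 x.
  rewrite /l0 scaler_sumr; apply: eq_bigr => i _.
  by rewrite linearZ /= scalerA -scalerAl mul1r scalerA.
have gl0 x : g (l0 x) = f x.
  rewrite linear_sum [in RHS](coord_vbasis (memvf x)) linear_sum /=.
  apply: eq_bigr => i _; rewrite linearZ /= mE -linearZ /=; congr (f _).
  by rewrite -[LHS]/(act P _ _) linearZ /= scale_lfunE act1 id_lfunE.
pose l (x : lmod_of P) : M := \sum_(i < p) t ^+ i *: l0 (H (act P (t ^+ (p.-1 - i)) x)).
have lD x y : l (x + y) = l x + l y.
  rewrite /l -big_split; apply: eq_bigr => i _.
  by rewrite !linearD /= l0D scalerDr.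
have lc (c : k) x : l (c%:A *: x) = c%:A *: l x.
  rewrite /l scaler_sumr; apply: eq_bigr => i _.
  have -> : c%:A *: x = c *: (x : fdSpace P).
    by rewrite -[LHS]/(act P _ _) linearZ /= scale_lfunE act1 id_lfunE.
  by rewrite !linearZ /= l0Z [LHS]scalerA [RHS]scalerA mulrC.
have lt x : l (t *: x) = t *: l x.
  pose F n m : M := t ^+ n *: l0 (H (act P (t ^+ m) x)).
  transitivity (\sum_(i < p) F i (p - i)%N).
    apply: eq_bigr => i _; rewrite /F; congr (_ *: l0 (H _)).
    rewrite -[t *: x]/(act P t x) -comp_lfunE -actM -exprSr -subSn ?prednK //.
    by rewrite -ltnS prednK.
  rewrite big_shift //; first by rewrite scaler_sumr; apply: eq_bigr => i _; rewrite scalerA -exprS.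
    rewrite /F Ap_t_exp linear0 zero_lfunE linear0.
    by rewrite -[0 : fdSpace P](scale0r 0) l0Z !scale0r scaler0.
  by rewrite /F Ap_t_exp scale0r.
have lq (q : Ap k p) x : l (q *: x) = q *: l x.
  have l0' : l 0 = 0 by have := lc 0 0; rewrite scale0r !scale0r.
  have ltn n y : l (t ^+ n *: y) = t ^+ n *: l y.
    elim: n y => [|n IH] y; first by rewrite !scale1r.
    by rewrite exprSr -!scalerA IH lt.
  rewrite (Ap_decomp q) !scaler_suml (big_morph l lD l0'); apply: eq_bigr => i _.
  by rewrite -[in LHS](mul1r (t ^+ i)) scalerAl -scalerA lc ltn scalerA -scalerAl mul1r.
have llin : linear l by move=> q x y; rewrite lD lq.
pose L : {linear lmod_of P -> M} := HB.pack l
  (GRing.isLinear.Build (Ap k p) _ _ _ l llin).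
exists L => x; rewrite /= /l linear_sum -[in RHS](HE x) linear_sum /=.
apply: eq_bigr => i _; rewrite linearZ /= gl0 -linearZ /= actX; congr (f _).
by rewrite -[LHS]/(act P _ _) actX.
Qed.

Lemma projectiveE : projective (lmod_of P) <-> exactp T p.
Proof. by split; [apply: projective_exactp | apply: exactp_projective]. Qed.
End Modules.
End TruncatedPolynomials.

(** * Tensor products and commutativity *)

Section TensorFacts.
Variables (k : fieldType) (V W : vectType k).

Lemma tpure_linl (w : W) : linear ((@tpure k V W)^~ w).
Proof.
by move=> c x y; apply/matrixP => i j; rewrite !mxE linearP mulrDl mulrA.
Qed.

Lemma tpure_linr (v : V) : linear (@tpure k V W v).
Proof.
by move=> c x y; apply/matrixP => i j; rewrite !mxE linearP mulrDr mulrCA.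
Qed.

Lemma linear_tliftE (U : lmodType k) (f : tensor V W -> U) T :
  linear f -> f T = tlift (fun x y => f (tpure x y)) T.
Proof.
move=> lf; pose F : {linear tensor V W -> U} := HB.pack f
  (GRing.isLinear.Build k _ _ _ f lf).
by rewrite -[in LHS](tlift_tpure T) -[f _]/(F _) linear_tlift.
Qed.

Lemma tensor_ext (U : lmodType k) (f g : tensor V W -> U) :
  linear f -> linear g -> (forall x y, f (tpure x y) = g (tpure x y)) -> f =1 g.
Proof.
by move=> lf lg fg T; rewrite (linear_tliftE _ lf) (linear_tliftE _ lg); apply: eq_tlift.
Qed.

Lemma tlift_exchange (V' W' : vectType k) (U : lmodType k)
    (b : V -> W -> V' -> W' -> U) S T :
  tlift (fun x y => tlift (b x y) T) S =
  tlift (fun x' y' => tlift (fun x y => b x y x' y') S) T.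
Proof.
rewrite /tlift.
transitivity (\sum_i \sum_j \sum_i' \sum_j' (S i j * T i' j') *:
   b (vbasis {:V})`_i (vbasis {:W})`_j (vbasis {:V'})`_i' (vbasis {:W'})`_j').
  apply: eq_bigr => i _; apply: eq_bigr => j _; rewrite scaler_sumr.
  by apply: eq_bigr => i' _; rewrite scaler_sumr; apply: eq_bigr => j' _; rewrite scalerA.
rewrite pair_bigA /=; under eq_bigr do rewrite pair_bigA /=.
rewrite exchange_big /= [RHS]pair_bigA /=; apply: eq_bigr => q _.
rewrite -(pair_bigA _ (fun i j => (S i j * T q.1 q.2) *:
  b (vbasis {:V})`_i (vbasis {:W})`_j (vbasis {:V'})`_q.1 (vbasis {:W'})`_q.2)) /= scaler_sumr.
apply: eq_bigr => i _; rewrite scaler_sumr.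
by apply: eq_bigr => j _; rewrite scalerA mulrC.
Qed.

Lemma tpure_neq0 (v : V) (w : W) : v != 0 -> w != 0 -> tpure v w != 0.
Proof.
have nz (X : vectType k) (x : X) : x != 0 -> exists i, coord (vbasis {:X}) i x != 0.
  move=> x0; apply/existsP; apply: contraNT x0; rewrite negb_exists => /forallP all0.
  rewrite (coord_vbasis (memvf x)) big1 // => i _.
  by have := all0 i; rewrite negbK => /eqP ->; rewrite scale0r.
move=> /nz[i vi] /nz[j wj]; apply/eqP => /matrixP/(_ i j) /eqP.
by rewrite !mxE mulf_eq0 (negPf vi) (negPf wj).
Qed.

End TensorFacts.

Section TensorMaps.
Variables (k : fieldType).

Lemma tensor_functional_eq0 (V W : vectType k) (T : tensor V W) :
  (forall (f : 'Hom(V, k^o)) (g : 'Hom(W, k^o)), tlift (fun x y => f x * g y : k^o) T = 0) ->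
  T = 0.
Proof.
move=> T0; apply/matrixP => i j; rewrite mxE.
rewrite -(T0 (linfun (coord (vbasis {:V}) i : V -> k^o)) (linfun (coord (vbasis {:W}) j : W -> k^o))).
rewrite -[in LHS](tlift_tpure T) /tlift summxE; apply: eq_bigr => i' _.
by rewrite summxE; apply: eq_bigr => j' _; rewrite mxE mxE !lfunE.
Qed.

Lemma tpureZr (V W : vectType k) (v : V) c (w : W) : tpure v (c *: w) = c *: tpure v w.
Proof. by apply/matrixP => i j; rewrite !mxE linearZ mulrCA. Qed.

Lemma tpure0l (V W : vectType k) (w : W) : tpure (0 : V) w = 0.
Proof. by apply/matrixP => i j; rewrite !mxE linear0 mul0r. Qed.

Lemma tlift_linear_param (V W : vectType k) (X U : lmodType k) (b : X -> V -> W -> U) T :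
  (forall x y, linear (fun z => b z x y)) -> linear (fun z => tlift (b z) T).
Proof.
move=> bl c z z'; rewrite scaler_tlift -tliftD.
by apply: eq_tlift => x y; rewrite bl.
Qed.

Variables (V W V' W' : vectType k) (f : {linear V -> V'}) (g : {linear W -> W'}).
Definition tmap : tensor V W -> tensor V' W' := tlift (fun x y => tpure (f x) (g y)).
HB.instance Definition _ := GRing.Linear.on tmap.

Lemma tmap_pure x y : tmap (tpure x y) = tpure (f x) (g y).
Proof.
rewrite /tmap tlift_pure //.
  by move=> w c u v; rewrite linearP tpure_linl.
by move=> w c u v; rewrite linearP tpure_linr.
Qed.

Lemma tlift_tmap (U : lmodType k) (b : V' -> W' -> U) T :
  (forall w, linear (b^~ w)) -> (forall v, linear (b v)) ->
  tlift b (tmap T) = tlift (fun x y => b (f x) (g y)) T.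
Proof.
by move=> bl br; rewrite /tmap linear_tlift; apply: eq_tlift => x y; rewrite [LHS]tlift_pure.
Qed.
End TensorMaps.

Section TensorAlgebra.
Variables (k : fieldType) (A B : falgType k).

Definition tprod : Type := tensor A B.
HB.instance Definition _ := Vector.copy tprod (tensor A B).

Definition tmul (S T : tprod) : tprod :=
  tlift (fun x y => tlift (fun x' y' => tpure (x * x') (y * y')) T) S.

Lemma tmul_linl T : linear (tmul^~ T).
Proof. by move=> c x y; rewrite /tmul linearP. Qed.

Lemma tmul_linr S : linear (tmul S).
Proof.
have E T : tmul S T =
    tlift (fun x' y' => tlift (fun x y => tpure (x * x') (y * y')) S) T.
  exact: tlift_exchange.
by move=> c x y; rewrite !E linearP.
Qed.

Lemma tmul_pure x y x' y' : tmul (tpure x y) (tpure x' y') = tpure (x * x') (y * y').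
Proof.
have linl z (b : B) : linear (fun a : A => tpure (z * a) b : tprod).
  by move=> c u v; rewrite mulrDr -scalerAr tpure_linl.
have linr (a : A) z : linear (fun b : B => tpure a (z * b) : tprod).
  by move=> c u v; rewrite mulrDr -scalerAr tpure_linr.
rewrite /tmul tlift_pure; first by rewrite tlift_pure.
- move=> b c u v; rewrite !tlift_pure //.
  by rewrite mulrDl -scalerAl tpure_linl.
- move=> a c u v; rewrite !tlift_pure //.
  by rewrite mulrDl -scalerAl tpure_linr.
Qed.

Let ext3 (U : lmodType k) (f g : tprod -> tprod -> tprod -> U) :
  (forall b c, linear (fun a => f a b c)) -> (forall a c, linear (fun b => f a b c)) ->
  (forall a b, linear (f a b)) ->
  (forall b c, linear (fun a => g a b c)) -> (forall a c, linear (fun b => g a b c)) ->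
  (forall a b, linear (g a b)) ->
  (forall x y x' y' x'' y'', f (tpure x y) (tpure x' y') (tpure x'' y'') =
     g (tpure x y) (tpure x' y') (tpure x'' y'')) -> forall a b c, f a b c = g a b c.
Proof.
move=> f1 f2 f3 g1 g2 g3 fg a b c.
move: a; apply: tensor_ext; [exact: f1|exact: g1|move=> x y].
move: b; apply: tensor_ext; [exact: f2|exact: g2|move=> x' y'].
move: c; apply: tensor_ext; [exact: f3|exact: g3|move=> x'' y''].
exact: fg.
Qed.

Fact tmulA : associative tmul.
Proof.
apply: ext3.
- by move=> b c e u v; rewrite tmul_linl.
- by move=> a c e u v; rewrite tmul_linl tmul_linr.
- by move=> a b e u v; rewrite !tmul_linr.
- by move=> b c e u v; rewrite !tmul_linl.
- by move=> a c e u v; rewrite tmul_linr tmul_linl.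
- by move=> a b e u v; rewrite tmul_linr.
by move=> *; rewrite !tmul_pure !mulrA.
Qed.

Let one : tprod := tpure 1 1.

Let id_linear (V : lmodType k) : linear (@id V). Proof. by []. Qed.

Fact tmul1 : left_id one tmul.
Proof.
apply: tensor_ext; [exact: tmul_linr|exact: id_linear|].
by move=> x y; rewrite tmul_pure !mul1r.
Qed.

Fact tmulr1 : right_id one tmul.
Proof.
apply: tensor_ext; [exact: tmul_linl|exact: id_linear|].
by move=> x y; rewrite tmul_pure !mulr1.
Qed.

Fact tmulDl : left_distributive tmul +%R.
Proof. by move=> x y z; have := tmul_linl z 1 x y; rewrite !scale1r. Qed.

Fact tmulDr : right_distributive tmul +%R.
Proof. by move=> x y z; have := tmul_linr x 1 y z; rewrite !scale1r. Qed.

Fact tone_neq0 : one != 0.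
Proof. by apply: tpure_neq0; rewrite oner_eq0. Qed.

HB.instance Definition _ := GRing.Zmodule_isNzRing.Build tprod
  tmulA tmul1 tmulr1 tmulDl tmulDr tone_neq0.

Fact tscaleAl c (u v : tprod) : c *: (u * v) = c *: u * v.
Proof. by have := tmul_linl v c u 0; rewrite addr0 (mul0r v : tmul 0 v = 0) addr0. Qed.
HB.instance Definition _ := GRing.Lmodule_isLalgebra.Build k tprod tscaleAl.

Fact tscaleAr c (u v : tprod) : c *: (u * v) = u * (c *: v).
Proof. by have := tmul_linr u c v 0; rewrite addr0 (mulr0 u : tmul u 0 = 0) addr0. Qed.
HB.instance Definition _ := GRing.Lalgebra_isAlgebra.Build k tprod tscaleAr.

Lemma tprod_mulC : (forall x y : A, x * y = y * x) -> (forall x y : B, x * y = y * x) ->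
  forall u v : tprod, u * v = v * u.
Proof.
move=> cA cB u v.
move: u; apply: tensor_ext; [exact: tmul_linl|exact: tmul_linr|move=> x y].
move: v; apply: tensor_ext; [exact: tmul_linr|exact: tmul_linl|move=> x' y'].
by rewrite [LHS]tmul_pure [RHS]tmul_pure cA cB.
Qed.

Definition tinl (x : A) : tprod := tpure x 1.
Definition tinr (y : B) : tprod := tpure 1 y.

Fact tinl_linear : linear tinl. Proof. exact: tpure_linl. Qed.
Fact tinr_linear : linear tinr. Proof. exact: tpure_linr. Qed.
Fact tinl_mult : monoid_morphism tinl.
Proof. by split=> // x y; rewrite [RHS]tmul_pure mul1r. Qed.
Fact tinr_mult : monoid_morphism tinr.
Proof. by split=> // x y; rewrite [RHS]tmul_pure mul1r. Qed.
HB.instance Definition _ := GRing.isLinear.Build k A tprod _ tinl tinl_linear.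
HB.instance Definition _ := GRing.isLinear.Build k B tprod _ tinr tinr_linear.
HB.instance Definition _ := GRing.isMonoidMorphism.Build A tprod tinl tinl_mult.
HB.instance Definition _ := GRing.isMonoidMorphism.Build B tprod tinr tinr_mult.

Lemma tinl_tinr x y : tinl x * tinr y = tpure x y.
Proof. by rewrite [LHS]tmul_pure mul1r mulr1. Qed.
Lemma tinr_tinl x y : tinr y * tinl x = tpure x y.
Proof. by rewrite [LHS]tmul_pure mul1r mulr1. Qed.

End TensorAlgebra.

Section Commutativity.
Variable k : fieldType.

Definition com_tprod (A B : falgType k) (cA : forall x y : A, x * y = y * x)
    (cB : forall x y : B, x * y = y * x) : comAlgType k :=
  HB.pack (tprod A B) (GRing.PzRing_hasCommutativeMul.Build (tprod A B) (tprod_mulC cA cB)).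

Definition com_coordRing (G : finGroupScheme k) : comAlgType k :=
  HB.pack (Falgebra.sort (coordRing G)) (GRing.PzRing_hasCommutativeMul.Build (coordRing G) (@coordRing_mulC k G)).

Definition evp (G H : finGroupScheme k) (u : measures G) (v : measures H)
  (x : coordRing G) (y : coordRing H) : k^o := meas_fun u x * meas_fun v y.

Lemma evp_linl (G H : finGroupScheme k) (u : measures G) (v : measures H) y :
  linear ((evp u v)^~ y).
Proof. by move=> c x x'; rewrite /evp linearP mulrDl -mulrA. Qed.

Lemma evp_linr (G H : finGroupScheme k) (u : measures G) (v : measures H) x :
  linear (evp u v x).
Proof. by move=> c y y'; rewrite /evp linearP mulrDr mulrCA. Qed.

Lemma evp_pure (G H : finGroupScheme k) (u : measures G) (v : measures H) x y :
  tlift (evp u v) (tpure x y) = meas_fun u x * meas_fun v y.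
Proof. by rewrite tlift_pure //; [exact: evp_linl | exact: evp_linr]. Qed.

(** It suffices to test the universal pair of points, the two inclusions of k[G] into k[G] (x) k[G].
    That they commute is cocommutativity of k[G], dual to commutativity of kG. *)
Lemma abelian_measures_mulC (G : finGroupScheme k) : abelian_scheme G ->
  forall u v : measures G, u * v = v * u.
Proof.
move=> abG u v; apply: measP => a; rewrite !meas_mulE.
pose R := com_tprod (@coordRing_mulC k G) (@coordRing_mulC k G).
pose g : points G R := @tinl k (coordRing G) (coordRing G).
pose h : points G R := @tinr k (coordRing G) (coordRing G).
have : tlift (fun x y => tpure x y : tprod _ _) (comul G a) =
    tlift (fun x y => tpure y x : tprod _ _) (comul G a).
  have := abG R g h a; rewrite /point_mul => E.
  transitivity (tlift (fun x y => g x * h y) (comul G a)).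
    by apply: eq_tlift => x y; rewrite [RHS]tinl_tinr.
  by rewrite E; apply: eq_tlift => x y; rewrite [LHS]tinr_tinl.
move/(congr1 (tlift (evp u v))); rewrite !linear_tlift => E.
transitivity (tlift (fun x y => tlift (evp u v) (tpure x y)) (comul G a)).
  by apply: eq_tlift => x y; rewrite [RHS]evp_pure.
by rewrite E; apply: eq_tlift => x y; rewrite [LHS]evp_pure mulrC.
Qed.

(** The generic point of Z, defined over k[Z] and pushed to k[Z] (x) k[G], must commute there with
    the generic point of G. *)
Lemma center_measures_mulC (G : finGroupScheme k) (Z : subgroupScheme G) : is_center Z ->
  forall (u : measures Z) (v : measures G), incl u * v = v * incl u.
Proof.
move=> cZ u v; apply: measP => a; rewrite !meas_mulE.
pose R := com_coordRing Z.
pose S := com_tprod (@coordRing_mulC k Z) (@coordRing_mulC k G).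
pose g : points G R := restr Z.
pose f : {lrmorphism R -> S} := @tinl k (coordRing Z) (coordRing G).
pose h : points G S := @tinr k (coordRing Z) (coordRing G).
have [cg _] := cZ R g.
have {}cg := cg (ex_intro (fun z : points Z R => g =1 z \o restr Z)
  (idfun : {lrmorphism coordRing Z -> coordRing Z}) (fun=> erefl)).
have : tlift (fun x y => tpure (restr Z x) y : tprod _ _) (comul G a) =
    tlift (fun x y => tpure (restr Z y) x : tprod _ _) (comul G a).
  have := cg S f h a; rewrite /point_mul => E.
  transitivity (tlift (fun x y => (f \o g) x * h y) (comul G a)).
    by apply: eq_tlift => x y; rewrite [RHS]tinl_tinr.
  by rewrite E; apply: eq_tlift => x y; rewrite [LHS]tinr_tinl.
move/(congr1 (tlift (evp u v))); rewrite !linear_tlift => E.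
transitivity (tlift (fun x y => tlift (evp u v) (tpure (restr Z x) y)) (comul G a)).
  by apply: eq_tlift => x y; rewrite [RHS]evp_pure inclE.
by rewrite E; apply: eq_tlift => x y; rewrite [LHS]evp_pure inclE mulrC.
Qed.
End Commutativity.

(** * Duality and freeness over unipotent subgroups *)

Section MeasureDuality.
Variables (k : fieldType) (G : finGroupScheme k).
Local Notation A := (coordRing G).
Local Notation H := (measures G).

Definition evm (a : A) (u : H) : k^o := meas_fun u a.
Fact evm_linear a : linear (evm a).
Proof. by move=> c u v; rewrite /evm meas_addE meas_scaleE. Qed.
HB.instance Definition _ a := GRing.isLinear.Build k H k^o _ (evm a) (evm_linear a).

Lemma meas_fun_sum I (r : seq I) (P : pred I) (F : I -> H) a :
  meas_fun (\sum_(i <- r | P i) F i) a = \sum_(i <- r | P i) meas_fun (F i) a.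
Proof. exact: (linear_sum (evm a)). Qed.

Lemma meas_fun0 a : meas_fun (0 : H) a = 0. Proof. exact: (linear0 (evm a)). Qed.

Lemma meas_fun1 : meas_fun (1 : H) 1 = 1.
Proof. by rewrite [LHS]meas_oneE rmorph1. Qed.

Definition mcoord (n : nat) (X : n.-tuple A) i : H := linfun (coord X i : A -> k^o).
Lemma mcoordE n (X : n.-tuple A) i a : meas_fun (mcoord X i) a = coord X i a.
Proof. exact: lfunE. Qed.

Local Notation e := (vbasis {:A}).

Lemma meas_eq0 a : (forall u : H, meas_fun u a = 0) -> a = 0.
Proof.
move=> a0; rewrite (coord_vbasis (memvf a)) big1 // => i _.
by rewrite -mcoordE a0 scale0r.
Qed.

Lemma meas_reflexive (phi : 'Hom(H, k^o)) : exists a, forall u, phi u = meas_fun u a.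
Proof.
exists (\sum_(i < \dim {:A}) (phi (mcoord e i) : k) *: e`_i) => u.
have -> : u = \sum_(i < \dim {:A}) (meas_fun u e`_i : k) *: mcoord e i.
  apply: measP => a; rewrite meas_fun_sum {1}(coord_vbasis (memvf a)) linear_sum.
  by apply: eq_bigr => i _; rewrite linearZ meas_scaleE mcoordE [RHS]mulrC.
rewrite linear_sum meas_fun_sum; apply: eq_bigr => i _.
rewrite linearZ meas_scaleE linear_sum; congr (_ * _).
rewrite (bigD1 i) //= big1 ?addr0 => [|j ji]; rewrite linearZ /= mcoordE.
  by rewrite coord_free ?(basis_free (vbasisP _)) // eqxx [RHS]mulr1.
by rewrite coord_free ?(basis_free (vbasisP _)) // (negPf ji) [LHS]mulr0.
Qed.

Lemma tensor_eq0 (T : tensor A A) :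
  (forall u v : H, tlift (evp u v) T = 0) -> T = 0.
Proof. by move=> T0; apply: tensor_functional_eq0 => f g; apply: (T0 f g). Qed.

Definition mtwist (a : A) (u : H) (f : A) : k^o := meas_fun u (a * f).
Fact mtwist_linear a u : linear (mtwist a u).
Proof. by move=> c f g; rewrite /mtwist mulrDr -scalerAr linearP. Qed.
HB.instance Definition _ a u := GRing.isLinear.Build k A k^o _ (mtwist a u) (mtwist_linear a u).

(** The product of the measure [u] with the function [a]; in Sweedler notation, u_1(a) u_2. *)
Definition Dm (a : A) (u : H) : H := linfun (mtwist a u).

Lemma DmE a u f : meas_fun (Dm a u) f = meas_fun u (a * f).
Proof. exact: lfunE. Qed.

Lemma Dm_linear a : linear (Dm a).
Proof.
by move=> c u v; apply: measP => f; rewrite meas_addE meas_scaleE !DmE meas_addE meas_scaleE.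
Qed.
HB.instance Definition _ a := GRing.isLinear.Build k H H _ (Dm a) (Dm_linear a).

Lemma Dm_linearl u : linear (Dm^~ u).
Proof.
move=> c a b; apply: measP => f; rewrite meas_addE meas_scaleE !DmE mulrDl linearD /=.
by rewrite -scalerAl linearZ.
Qed.

Lemma coord_mulCA (a b c : A) : a * (b * c) = b * (a * c).
Proof. by rewrite !mulrA [a * b]coordRing_mulC. Qed.

Lemma tlift_evm (V W : vectType k) (b : V -> W -> H) (T : tensor V W) f :
  meas_fun (tlift b T) f = tlift (fun x y => meas_fun (b x y) f) T.
Proof. exact: (linear_tlift (evm f)). Qed.

Lemma DmM a (u v : H) : Dm a (u * v) = tlift (fun x y => Dm x u * Dm y v) (comul G a).
Proof.
apply: measP => f; rewrite DmE [LHS]meas_mulE tlift_evm comulM linear_tlift.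
apply: eq_tlift => x y; rewrite linear_tlift [RHS]meas_mulE.
by apply: eq_tlift => x' y'; rewrite [LHS]evp_pure !DmE.
Qed.

(** The transpose of left multiplication by [r] on kG ([LtrE]), hence a right action of kG on k[G]
    ([LtrM]). *)
Definition Ltr (r : H) (a : A) : A := tlift (fun x y => (meas_fun r x : k) *: y) (comul G a).
Fact Ltr_linear r : linear (Ltr r).
Proof. by move=> c a b; rewrite /Ltr !linearP. Qed.
HB.instance Definition _ r := GRing.isLinear.Build k A A _ (Ltr r) (Ltr_linear r).

Lemma LtrE r (h : H) a : meas_fun h (Ltr r a) = meas_fun (r * h) a.
Proof.
rewrite [RHS]meas_mulE linear_tlift; apply: eq_tlift => x y.
by rewrite linearZ.
Qed.

Lemma Ltr_linearl a : linear (Ltr^~ a).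
Proof.
move=> c r s; apply/eqP; rewrite -subr_eq0; apply/eqP/meas_eq0 => u.
by rewrite linearB linearD linearZ /= !LtrE mulrDl -scalerAl meas_addE meas_scaleE subrr.
Qed.

Lemma Ltr1 a : Ltr 1 a = a.
Proof.
apply/eqP; rewrite -subr_eq0; apply/eqP/meas_eq0 => u.
by rewrite linearB /= LtrE mul1r subrr.
Qed.

Lemma LtrM r s a : Ltr r (Ltr s a) = Ltr (s * r) a.
Proof.
apply/eqP; rewrite -subr_eq0; apply/eqP/meas_eq0 => u.
by rewrite linearB /= !LtrE mulrA subrr.
Qed.

Definition manti (u : H) : H := linfun (meas_fun u \o antipode G).
Lemma mantiE u a : meas_fun (manti u) a = meas_fun u (antipode G a).
Proof. exact: lfunE. Qed.

(* Sum of S(h_1) h_2 h_3(c) = h(c) 1 in Sweedler notation.                    *)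
Lemma antipode_sum (h : H) (c : A) :
  \sum_(s < \dim {:A}) manti (mcoord e s) * Dm c (Dm e`_s h) = (meas_fun h c : k)%:A.
Proof.
apply: measP => f; rewrite meas_fun_sum [RHS]meas_scaleE [meas_fun 1 f]meas_oneE.
transitivity (tlift (fun x y => meas_fun h (c * (antipode G x * y))) (comul G f)).
  transitivity (\sum_(s < \dim {:A}) tlift (fun x y =>
      meas_fun (manti (mcoord e s)) x * meas_fun (Dm c (Dm e`_s h)) y) (comul G f)).
    by apply: eq_bigr => s _; rewrite [LHS]meas_mulE.
  rewrite /tlift exchange_big; apply: eq_bigr => i _ /=; rewrite exchange_big.
  apply: eq_bigr => j _ /=; rewrite -scaler_sumr; congr (_ *: _).
  set x := (vbasis _)`_i; set y := (vbasis _)`_j.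
  rewrite [in RHS](coord_vbasis (memvf (antipode G x))) mulr_suml mulr_sumr linear_sum.
  apply: eq_bigr => s _; rewrite mantiE mcoordE !DmE -scalerAl -scalerAr linearZ /=.
  by congr (_ * meas_fun h _); rewrite coord_mulCA.
have hc : linear (fun z => meas_fun h (c * z)) by move=> a z z'; rewrite mulrDr -scalerAr linearP.
pose F : {linear A -> k^o} := HB.pack (fun z => meas_fun h (c * z)) (GRing.isLinear.Build k A k^o _ _ hc).
rewrite -[LHS](linear_tlift F) antipodel /= -scalerAr mulr1 linearZ.
by rewrite [LHS]mulrC.
Qed.
End MeasureDuality.

Section Unipotent.
Variables (k : fieldType) (U : finGroupScheme k).
Local Notation R := (measures U).

Section StableSubspace.
Variables (X : vectType k) (rho : R -> X -> X).
Hypotheses (rl : forall x, linear (rho^~ x)) (rr : forall u, linear (rho u)).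
Hypotheses (r1 : forall x, rho 1 x = x).
Hypothesis rM : forall u v x, rho (u * v) x = rho u (rho v x).
Variable W : {vspace X}.
Hypothesis rW : forall u x, x \in W -> rho u x \in W.

Let f u (x : subvs_of W) : subvs_of W := vsproj W (rho u (vsval x)).
Let fE u x : vsval (f u x) = rho u (vsval x).
Proof. by rewrite vsprojK // rW ?subvsP. Qed.

Let f_lin u : linear (f u).
Proof. by move=> c x y; apply: val_inj; rewrite /= !fE /= rr. Qed.

Let F u : 'End(subvs_of W) := mklfun (f_lin u).

Let F_lin : linear F.
Proof.
move=> c u v; apply/lfunP => x; rewrite add_lfunE scale_lfunE !mklfunE.
by apply: val_inj; rewrite /= !fE rl.
Qed.

Let FL : {linear R -> 'End(subvs_of W)} := HB.pack F (GRing.isLinear.Build k _ _ _ F F_lin).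

Let FL1 : FL 1 = \1%VF.
Proof. by apply/lfunP => x; rewrite mklfunE id_lfunE; apply: val_inj; rewrite /= fE. Qed.

Let FLM u v : FL (u * v) = (FL u \o FL v)%VF.
Proof.
apply/lfunP => x; rewrite comp_lfunE !mklfunE; apply: val_inj.
by rewrite /= !fE rM.
Qed.

(** Unipotence for an unbundled action, with the fixed vector located in a prescribed stable
    subspace. *)
Lemma unipotent_fixed : unipotent U -> W != 0%VS ->
  exists x, [/\ x \in W, x != 0 & forall u, rho u x = (meas_fun u 1 : k) *: x].
Proof.
move=> uU W0; have [|m m0 mfix] := uU (FdModule FL1 FLM).
  have [x xW x0] : exists2 x, x \in W & x != 0.
    by exists (vpick W); rewrite ?memv_pick // vpick0.
  by exists (vsproj W x : subvs_of W); rewrite -(inj_eq val_inj) /= vsprojK.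
exists (vsval (m : subvs_of W)); split; first exact: subvsP.
  by rewrite -(inj_eq val_inj) in m0.
move=> u; have := congr1 vsval (mfix u : _ = _ :> subvs_of W).
by rewrite /= mklfunE fE.
Qed.
End StableSubspace.

Hypothesis cU : forall u v : R, u * v = v * u.

Let mCA (u v w : R) : u * (v * w) = v * (u * w).
Proof. by rewrite !mulrA (cU u). Qed.

Lemma unipotent_nil : unipotent U -> forall x : R, meas_fun x 1 = 0 -> exists n, x ^+ n = 0.
Proof.
move=> uU x x1; pose f := amull x.
have fE y : f y = x * y by rewrite lfunE.
have [|W [n Wn] Wmin] := @ex_min_vspace k R
    (fun W => exists n, forall y, y \in W <-> exists z, y = x ^+ n * z) {:R}%VS.
  by exists 0%N => y; split=> _; [exists y; rewrite mul1r | apply: memvf].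
have fW : (f @: W)%VS = W.
  apply/eqP; rewrite eqEdim; apply/andP; split.
    apply/subvP => _ /memv_imgP[y /Wn[z ->] ->]; apply/Wn; exists (x * z).
    by rewrite fE mCA.
  apply: Wmin; exists n.+1 => y; split.
    by move=> /memv_imgP[_ /Wn[z ->] ->]; exists z; rewrite fE exprS mulrA.
  move=> [z ->]; rewrite exprS -mulrA -fE memv_img //; apply/Wn; by exists z.
have Winj : (W :&: lker f)%VS = 0%VS.
  apply/eqP; rewrite -dimv_eq0 -(eqn_add2r (\dim (f @: W))) limg_ker_dim fW.
  by rewrite add0n.
have [W0|W0] := eqVneq W 0%VS.
  exists n; apply/eqP; rewrite -memv0 -W0; apply/Wn; exists 1; by rewrite mulr1.
have [|||||m [mW m0 mfix]] := @unipotent_fixed R (fun u y => u * y) _ _ _ _ W _ uU W0.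
- by move=> y c u v; rewrite mulrDl scalerAl.
- by move=> u c y z; rewrite mulrDr -scalerAr.
- exact: mul1r.
- by move=> u v y; rewrite mulrA.
- by move=> u _ /Wn[z ->]; apply/Wn; exists (u * z); rewrite mCA.
suff : m \in 0%VS by rewrite memv0 (negPf m0).
by rewrite -Winj memv_cap mW memv_ker fE mfix x1 scale0r eqxx.
Qed.

(** Let W be a nonzero submodule of least dimension and x of augmentation 0. Then x W is a
    submodule, hence 0 or W, and nilpotency excludes W. So U fixes every vector of W. *)
Lemma nil_unipotent : (forall x : R, meas_fun x 1 = 0 -> exists n, x ^+ n = 0) -> unipotent U.
Proof.
move=> nil M [m m0].
pose P (W : {vspace M}) := W != 0%VS /\ forall u x, x \in W -> act M u x \in W.
have [|W [W0 Wst] Wmin] := @ex_min_vspace k M P {:fdSpace M}%VS.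
  split; last by move=> *; apply: memvf.
  by apply: contraNneq m0 => W0; rewrite -memv0 -W0 memvf.
have kill (x : R) w : meas_fun x 1 = 0 -> w \in W -> act M x w = 0.
  move=> x1; pose f := act M x.
  have fW : (f @: W <= W)%VS by apply/subvP => _ /memv_imgP[y yW ->]; apply: Wst.
  have [f0|f0] := eqVneq (f @: W)%VS 0%VS.
    by move=> wW; apply/eqP; rewrite -memv0 -f0 memv_img.
  have fWE : (f @: W)%VS = W.
    apply/eqP; rewrite eqEdim fW; apply: Wmin; split=> // u _ /memv_imgP[y yW ->].
    by rewrite -comp_lfunE -actM cU actM comp_lfunE memv_img ?Wst.
  have [n xn] := nil x x1.
  case/negP: W0; rewrite -subv0; apply/subvP => v.
  suff -> : W = (act M (x ^+ n) @: W)%VS.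
    by move=> /memv_imgP[y _ ->]; rewrite xn linear0 zero_lfunE mem0v.
  elim: n {xn} => [|n IH]; first by rewrite expr0 act1 lim1g.
  by rewrite exprS actM limg_comp -IH.
exists (vpick W); first by rewrite vpick0.
move=> u; apply/eqP; rewrite -subr_eq0; apply/eqP.
transitivity (act M (u - (meas_fun u 1 : k)%:A) (vpick W)).
  by rewrite linearB [act M _%:A]linearZ /= act1 add_lfunE opp_lfunE scale_lfunE id_lfunE.
apply: kill; last exact: memv_pick.
by rewrite -scaleN1r meas_addE !meas_scaleE meas_fun1 mulr1 mulN1r subrr.
Qed.
End Unipotent.

Section Inclusions.
Variables (k : fieldType) (G : finGroupScheme k) (U : subgroupScheme G).

Lemma incl_inj : injective (@incl k G U).
Proof.
move=> u v uv; apply: measP => b; have [a <-] := restr_surj b.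
by rewrite -!inclE uv.
Qed.

Lemma Dm_incl a (u : measures U) : Dm a (incl u) = incl (Dm (restr U a) u).
Proof. by apply: measP => f; rewrite DmE !inclE DmE rmorphM. Qed.

Lemma incl1E (u : measures U) : meas_fun (incl u) 1 = meas_fun u 1.
Proof. by rewrite inclE rmorph1. Qed.
End Inclusions.

Section Freeness.
Variables (k : fieldType) (G : finGroupScheme k) (U : subgroupScheme G).
Local Notation A := (coordRing G).
Local Notation H := (measures G).
Local Notation R := (measures U).
Hypotheses (cU : forall u v : R, u * v = v * u) (uU : unipotent U).

Let inv (a : A) := forall r : R, Ltr (incl r) a = (meas_fun r 1 : k) *: a.

(** In r(c_1 f_1) c_2 f_2 the measure [Dm f_1 r] comes again from kU ([Dm_incl]), so invariance of c
    replaces its translate of c by a scalar multiple. *)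
Let Ltr_inv c (r : R) f : inv c -> Ltr (incl r) (c * f) = c * Ltr (incl r) f.
Proof.
move=> cinv; rewrite [c * f]coordRing_mulC /Ltr comulM linear_tlift.
have cl : linear ( *%R c) by move=> e x y; rewrite mulrDr -scalerAr.
pose cF : {linear A -> A} := HB.pack ( *%R c) (GRing.isLinear.Build k A A _ _ cl).
rewrite -[RHS]/(cF _) linear_tlift; apply: eq_tlift => x y; rewrite linear_tlift.
transitivity (y * Ltr (Dm x (incl r)) c).
  have yl : linear ( *%R y) by move=> e z z'; rewrite mulrDr -scalerAr.
  pose yF : {linear A -> A} := HB.pack ( *%R y) (GRing.isLinear.Build k A A _ _ yl).
  rewrite -[RHS]/(yF _) linear_tlift; apply: eq_tlift => x' y'.
  rewrite [LHS]tlift_pure; first by rewrite /= DmE scalerAr.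
    by move=> w e z z'; rewrite linearP scalerDl -scalerA.
  by move=> v e z z'; rewrite scalerDr !scalerA mulrC.
rewrite Dm_incl cinv DmE mulr1 inclE /= -!scalerAr.
by rewrite coordRing_mulC.
Qed.

Let Dm_inv c (r : R) (h : H) : inv c -> Dm c (incl r * h) = incl r * Dm c h.
Proof.
by move=> cinv; apply: measP => f; rewrite DmE -!LtrE Ltr_inv // DmE.
Qed.

(* e is dual to a basis c of the functions invariant under U. The operators   *)
(* D_c are kU-linear, and the matrix (D_(c_j) e_i) over kG is invertible      *)
(* because, by the antipode, its columns span.                                *)
Theorem measures_free : exists (n : nat) (e : 'I_n -> H),
  (forall h, exists r : 'I_n -> R, h = \sum_i incl (r i) * e i) /\
  (forall r : 'I_n -> R, \sum_i incl (r i) * e i = 0 -> forall i, r i = 0).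
Proof.
have [|c a b ai bi r|C CP] := @ex_vspace k A inv.
- by move=> r; rewrite linear0 scaler0.
- by rewrite linearD linearZ /= ai bi scalerDr !scalerA mulrC.
pose c := vbasis C; pose n := \dim C; pose e i : H := mcoord c i.
have cinv (j : 'I_n) : inv c`_j by apply/CP/vbasis_mem/mem_nth; rewrite size_tuple.
have ec i (j : 'I_n) : meas_fun (e i) c`_j = (i == j)%:R.
  by rewrite mcoordE coord_free ?(basis_free (vbasisP C)) // eq_sym.
(* Otherwise some nonzero function is killed by all measures r e_i. Such functions form a U-stable
   space, which then contains a nonzero invariant function; but all coordinates of that function in
   the basis c of C vanish. *)
have span h : exists r : 'I_n -> R, h = \sum_i incl (r i) * e i.
  pose SP h := exists r : 'I_n -> R, h = \sum_i incl (r i) * e i.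
  have [|a x y [r ->] [s ->]|S S_P] := @ex_vspace k H SP.
  - by exists (fun=> 0); rewrite big1 // => i _; rewrite linear0 mul0r.
  - exists (fun i => a *: r i + s i); rewrite scaler_sumr -big_split.
    by apply: eq_bigr => i _; rewrite linearP mulrDl scalerAl.
  apply/S_P/negPn/negP => /separate[phi phih phiS].
  have [a aE] := meas_reflexive phi.
  pose A0P b := forall (r : R) i, meas_fun (incl r * e i) b = 0.
  have [|z x y x0 y0 r i|A0 A0E] := @ex_vspace k A A0P.
  - by move=> r i; rewrite linear0.
  - by rewrite linearP /= x0 y0 scaler0 addr0.
  have aA0 : a \in A0.
    apply/A0E => r i; rewrite -aE phiS //; apply/S_P.
    exists (fun j => if j == i then r else 0).
    rewrite (bigD1 i) //= eqxx big1 ?addr0 // => j /negPf ->.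
    by rewrite linear0 mul0r.
  have A00 : A0 != 0%VS.
    apply/eqP => A00; move: aA0 phih; rewrite A00 memv0 => /eqP a0.
    by rewrite aE a0 linear0 => /eqP; rewrite eq_sym oner_eq0.
  have [|||||b [bA0 b0 bfix]] :=
      @unipotent_fixed k U A (fun u x => Ltr (incl u) x) _ _ _ _ A0 _ uU A00.
  - by move=> x z u v; rewrite linearP Ltr_linearl.
  - by move=> u z x y; rewrite linearP.
  - by move=> x; rewrite rmorph1 Ltr1.
  - by move=> u v x; rewrite LtrM -rmorphM /= cU.
  - by move=> u x /A0E x0; apply/A0E => r i; rewrite LtrE mulrA -rmorphM x0.
  have bC : b \in C by apply/CP.
  case/eqP: b0; rewrite (coord_vbasis bC) big1 // => i _; rewrite -mcoordE.
  have /A0E/(_ 1 i) := bA0; rewrite rmorph1 mul1r => ->; exact: scale0r.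
exists n, e; split=> // r r0.
have /choice[s sE] := span.
have DmS (j : 'I_n) h : Dm c`_j h = \sum_i incl (s h i) * Dm c`_j (e i).
  by rewrite {1}(sE h) linear_sum; apply: eq_bigr => i _; apply: Dm_inv.
(* [xi] multiplies a row over kG by the matrix (D_(c_j) e_i). By [Dm_inv] it sends the row of a
   relation to D_(c_j) of that relation, thus to 0. Source and target coincide, so surjectivity
   gives injectivity. *)
pose xi (g : {ffun 'I_n -> H}) : {ffun 'I_n -> H} :=
  [ffun j : 'I_n => \sum_i g i * Dm c`_j (e i)].
have xi_lin : linear xi.
  move=> z g h; apply/ffunP => j; rewrite !ffunE scaler_sumr -big_split.
  by apply: eq_bigr => i _; rewrite !ffunE mulrDl scalerAl.
pose Xi := mklfun xi_lin.
have Xi_surj : limg Xi = fullv.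
  apply/vspaceP => g; rewrite memvf; apply/memv_imgP.
  pose a := vbasis {:A}; pose v l (t : 'I_(\dim {:A})) := Dm a`_t (e l).
  exists [ffun i => \sum_l \sum_t g l * manti (mcoord a t) * incl (s (v l t) i)].
    exact: memvf.
  apply/ffunP => j; rewrite mklfunE ffunE.
  have col l : \sum_i (\sum_t g l * manti (mcoord a t) * incl (s (v l t) i)) * Dm c`_j (e i) =
      g l * ((l == j)%:R : k)%:A.
    rewrite -ec -antipode_sum mulr_sumr.
    rewrite (eq_bigr (fun i => \sum_t g l * manti (mcoord a t) * incl (s (v l t) i) * Dm c`_j (e i))).
      rewrite exchange_big /=; apply: eq_bigr => t _; rewrite DmS !mulr_sumr.
      by apply: eq_bigr => i _; rewrite !mulrA.
    by move=> i _; rewrite mulr_suml.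
  transitivity (\sum_l g l * ((l == j)%:R : k)%:A).
    rewrite (bigD1 j) //= eqxx scale1r mulr1 big1 ?addr0 // => l /negPf ->.
    by rewrite scale0r mulr0.
  rewrite -(eq_bigr _ (fun l _ => col l)) exchange_big /=.
  by apply: eq_bigr => i _; rewrite ffunE mulr_suml.
have Xi_inj : lker Xi == 0%VS.
  rewrite -dimv_eq0 -(eqn_add2r (\dim (limg Xi))) -(capfv (lker Xi)) limg_ker_dim.
  by rewrite Xi_surj add0n.
have : Xi [ffun i => incl (r i)] = 0.
  rewrite mklfunE; apply/ffunP => j; rewrite !ffunE.
  transitivity (Dm c`_j (\sum_i incl (r i) * e i)); last by rewrite r0 linear0.
  by rewrite linear_sum; apply: eq_bigr => i _; rewrite ffunE [RHS]Dm_inv.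
rewrite -[RHS](linear0 Xi) => /(lker0P Xi_inj)/ffunP ri0 i.
by apply: (@incl_inj k G U); have := ri0 i; rewrite !ffunE linear0.
Qed.

(** In a basis of kG over kU, multiplication by [incl b] acts on each coordinate as multiplication
    by b. *)
Lemma incl_exactp (b : R) p : exactp (amull b) p -> exactp (amull (incl b)) p.
Proof.
have [n [e [span free]]] := measures_free.
move=> ex h; have [r ->] := span h; rewrite amullE mulr_sumr.
under eq_bigr do rewrite mulrA -rmorphM /=.
move/free => br0.
have /choice[s sE] : forall i, exists s, r i = b ^+ p.-1 * s.
  move=> i; have [|s] := ex (r i); first by rewrite amullE br0.
  by rewrite iter_amull; exists s.
exists (\sum_i incl (s i) * e i); rewrite iter_amull mulr_sumr; apply: eq_bigr => i _.
by rewrite sE rmorphM rmorphXn mulrA.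
Qed.

End Freeness.

(** * Subgroups from sub-bialgebras of kG *)

(** [sbD] encodes being a subcoalgebra: it makes the annihilator of [sbspace] an ideal of k[G]
    ([pi_ideal]). Compatibility with the antipode is derived in [antipode_pi]. *)
Record subBialg (k : fieldType) (G : finGroupScheme k) := SubBialg {
  sbspace :> {vspace measures G};
  sb1 : 1 \in sbspace;
  sbM : forall u v, u \in sbspace -> v \in sbspace -> u * v \in sbspace;
  sbD : forall a u, u \in sbspace -> Dm a u \in sbspace
}.

Section Quotient.
Variables (k : fieldType) (G : finGroupScheme k) (S : subBialg G).
Local Notation A := (coordRing G).
Local Notation H := (measures G).

(** k[G] modulo the annihilator of S, a class being recorded by its values on a basis of S. *)
Definition quot : Type := 'rV[k]_(\dim S).
HB.instance Definition _ := Vector.copy quot 'rV[k]_(\dim S).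

Definition pi (a : A) : quot := \row_i meas_fun (vbasis S)`_i a.
Fact pi_linear : linear pi.
Proof. by move=> c a b; apply/rowP => i; rewrite !mxE linearP. Qed.
HB.instance Definition _ := GRing.isLinear.Build k A quot _ pi pi_linear.

Lemma pi_eq0 a : pi a = 0 <-> forall u, u \in sbspace S -> meas_fun u a = 0.
Proof.
split=> [pa u uS|a0]; last first.
  by apply/rowP => i; rewrite !mxE a0 // vbasis_mem // mem_nth // size_tuple.
rewrite (coord_vbasis uS) meas_fun_sum big1 // => i _; rewrite meas_scaleE.
by move/rowP/(_ i): pa; rewrite !mxE => ->; rewrite mulr0.
Qed.

Definition qfun (f : 'Hom(quot, k^o)) : H := linfun (f \o pi).
Lemma qfunE f a : meas_fun (qfun f) a = f (pi a). Proof. exact: lfunE. Qed.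

Lemma qfun_mem f : qfun f \in sbspace S.
Proof.
suff -> : qfun f = \sum_i (f (delta_mx 0 i) : k) *: (vbasis S)`_i.
  by apply: memv_suml => i _; rewrite memvZ // vbasis_mem // mem_nth // size_tuple.
apply: measP => a; rewrite qfunE meas_fun_sum [pi a]row_sum_delta linear_sum.
by apply: eq_bigr => i _; rewrite linearZ meas_scaleE mxE [RHS]mulrC.
Qed.

(** A functional vanishing on the image of [pi] would be a linear relation between the basis vectors
    of S. *)
Lemma pi_surj x : exists a, pi a = x.
Proof.
suff: x \in limg (linfun pi) by move=> /memv_imgP[a _ ->]; exists a; rewrite lfunE.
apply/negPn/negP => /separate[phi phix phi0].
have : qfun phi = 0.
  apply: measP => a; rewrite qfunE meas_fun0 phi0 //.
  by rewrite -[pi a](lfunE pi) memv_img ?memvf.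
have -> : qfun phi = \sum_i (phi (delta_mx 0 i) : k) *: (vbasis S)`_i.
  apply: measP => a; rewrite qfunE meas_fun_sum [pi a]row_sum_delta linear_sum.
  by apply: eq_bigr => i _; rewrite linearZ meas_scaleE mxE [RHS]mulrC.
have /freeP fr := basis_free (vbasisP S); move/fr => phii.
move: phix; rewrite [x]row_sum_delta linear_sum big1 => [/eqP|i _].
  by rewrite eq_sym oner_eq0.
by rewrite linearZ /= phii scaler0.
Qed.

Definition sec (x : quot) : A := ((linfun pi)^-1)%VF x.
Lemma secK x : pi (sec x) = x.
Proof.
rewrite -[LHS](lfunE pi) limg_lfunVK //; have [a <-] := pi_surj x.
by rewrite -(lfunE pi) memv_img ?memvf.
Qed.
Fact sec_linear : linear sec. Proof. by move=> c x y; rewrite /sec linearP. Qed.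
HB.instance Definition _ := GRing.isLinear.Build k quot A _ sec sec_linear.

Lemma fact_pi (X : lmodType k) (f : {linear A -> X}) :
  (forall a, pi a = 0 -> f a = 0) -> forall a, f (sec (pi a)) = f a.
Proof.
move=> f0 a; apply/eqP; rewrite -subr_eq0 -linearB; apply/eqP/f0.
by rewrite linearB /= secK subrr.
Qed.

Definition qmul (x y : quot) : quot := pi (sec x * sec y).

Lemma pi_ideal a b : pi a = 0 -> pi (a * b) = 0.
Proof.
move=> /pi_eq0 a0; apply/pi_eq0 => u uS; rewrite coordRing_mulC -DmE.
by rewrite a0 // sbD.
Qed.

Lemma pi_mul a b : pi (a * b) = qmul (pi a) (pi b).
Proof.
rewrite /qmul; apply/eqP; rewrite -subr_eq0 -linearB /=.
rewrite -(subrK (sec (pi a) * b) (a * b)) -addrA -mulrBl -mulrBr linearD /=.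
rewrite pi_ideal ?add0r; last by rewrite linearB /= secK subrr.
by rewrite coordRing_mulC pi_ideal // linearB /= secK subrr.
Qed.

Let ex1 (P : quot -> Prop) : (forall a, P (pi a)) -> forall x, P x.
Proof. by move=> Ppi x; have [a <-] := pi_surj x. Qed.

Fact qmulA : associative qmul.
Proof.
by elim/ex1=> a; elim/ex1=> b; elim/ex1=> c; rewrite -!pi_mul mulrA.
Qed.
Fact qmul1 : left_id (pi 1) qmul.
Proof. by elim/ex1=> a; rewrite -pi_mul mul1r. Qed.
Fact qmulr1 : right_id (pi 1) qmul.
Proof. by elim/ex1=> a; rewrite -pi_mul mulr1. Qed.
Fact qmulDl : left_distributive qmul +%R.
Proof. by move=> x y z; rewrite /qmul linearD mulrDl linearD. Qed.
Fact qmulDr : right_distributive qmul +%R.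
Proof. by move=> x y z; rewrite /qmul linearD mulrDr linearD. Qed.
Fact qone_neq0 : pi 1 != 0.
Proof.
by apply/eqP => /pi_eq0 /(_ 1 (sb1 S)) /eqP; rewrite meas_fun1 oner_eq0.
Qed.
HB.instance Definition _ := GRing.Zmodule_isNzRing.Build quot
  qmulA qmul1 qmulr1 qmulDl qmulDr qone_neq0.
Fact qscaleAl c (x y : quot) : c *: (x * y) = c *: x * y.
Proof. by rewrite -[RHS]/(qmul _ _) /qmul !linearZ -scalerAl linearZ. Qed.
HB.instance Definition _ := GRing.Lmodule_isLalgebra.Build k quot qscaleAl.
Fact qscaleAr c (x y : quot) : c *: (x * y) = x * (c *: y).
Proof. by rewrite -[RHS]/(qmul _ _) /qmul !linearZ -scalerAr linearZ. Qed.
HB.instance Definition _ := GRing.Lalgebra_isAlgebra.Build k quot qscaleAr.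
HB.instance Definition _ := Algebra_isFalgebra.Build k quot.

Fact pi_monoid : monoid_morphism pi.
Proof. by split=> // a b; rewrite pi_mul. Qed.
HB.instance Definition _ := GRing.isMonoidMorphism.Build A quot pi pi_monoid.

Fact quot_mulC (x y : quot) : x * y = y * x.
Proof. by move: x y; elim/ex1=> a; elim/ex1=> b; rewrite -!rmorphM /= coordRing_mulC. Qed.

Local Notation pp := (tmap pi pi).

Definition qcomul (x : quot) : tensor quot quot := pp (comul G (sec x)).
Fact qcomul_linear : linear qcomul. Proof. by move=> c x y; rewrite /qcomul !linearP. Qed.
HB.instance Definition _ := GRing.isLinear.Build k quot (tensor quot quot) _ qcomul qcomul_linear.

(** The coproduct descends because S is closed under products: functionals of the form f (x) g on
    the tensor square of [quot] are given by pairs of elements of S. *)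
Lemma qcomulE a : qcomul (pi a) = pp (comul G a).
Proof.
apply: (fact_pi (f := pp \o comul G)) => {}a /pi_eq0 a0 /=.
apply: tensor_functional_eq0 => f g; rewrite tlift_tmap.
- rewrite -(a0 (qfun f * qfun g)) ?sbM ?qfun_mem // [RHS]meas_mulE.
  by apply: eq_tlift => x y; rewrite !qfunE.
- by move=> w c u v; rewrite linearP mulrDl -mulrA.
- by move=> w c u v; rewrite linearP mulrDr mulrCA.
Qed.

Fact qcomul1 : qcomul 1 = tpure 1 1.
Proof. by rewrite [LHS](qcomulE 1) comul1 tmap_pure. Qed.

Lemma pp_tmul (X Y : tprod A A) : pp (tmul X Y) = tmul (pp X) (pp Y).
Proof.
move: X; apply: tensor_ext => [c u v|c u v|x y].
- by rewrite tmul_linl linearP.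
- by rewrite linearP tmul_linl.
move: Y; apply: tensor_ext => [c u v|c u v|x' y'].
- by rewrite tmul_linr linearP.
- by rewrite linearP tmul_linr.
by rewrite tmul_pure !tmap_pure tmul_pure !rmorphM.
Qed.

Fact qcomulM (x y : quot) : qcomul (x * y) = tmul (qcomul x) (qcomul y).
Proof.
move: x y; elim/ex1=> a; elim/ex1=> b; rewrite -rmorphM /= !qcomulE -pp_tmul.
by rewrite comulM.
Qed.

Fact qcomulA x :
  tlift (fun x y => tpure x (qcomul y)) (qcomul x) =
  tlift (fun x y => tlift (fun x1 x2 => tpure x1 (tpure x2 y)) (qcomul x)) (qcomul x).
Proof.
elim/ex1: x => a; rewrite qcomulE.
have E := congr1 (tmap pi pp) (comulA a); rewrite !linear_tlift in E.
rewrite tlift_tmap; last 2 first.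
- by move=> w; apply: tpure_linl.
- by move=> w c u v; rewrite linearP tpure_linr.
transitivity (tlift (fun x y => tmap pi pp (tpure x (comul G y))) (comul G a)).
  by apply: eq_tlift => x y; rewrite tmap_pure qcomulE.
rewrite {}E tlift_tmap; last 2 first.
- by move=> w c u v; rewrite !linearP.
- by move=> w; apply: tlift_linear_param => x y c u v; rewrite tpure_linr tpure_linr.
apply: eq_tlift => x y; rewrite linear_tlift qcomulE tlift_tmap; last 2 first.
- by move=> w; apply: tpure_linl.
- by move=> w c u v; rewrite tpure_linl tpure_linr.
by apply: eq_tlift => x1 x2; rewrite [LHS]tmap_pure /= tmap_pure.
Qed.

Lemma counit_pi a : pi a = 0 -> counit G a = 0.
Proof. by move=> /pi_eq0 /(_ 1 (sb1 S)); rewrite [meas_fun _ _]meas_oneE. Qed.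

Definition qcounit (x : quot) : k^o := counit G (sec x).
Lemma qcounitE a : qcounit (pi a) = counit G a.
Proof. exact: (fact_pi (f := counit G)) counit_pi a. Qed.
Fact qcounit_linear : linear qcounit.
Proof. by move=> c x y; rewrite /qcounit !linearP. Qed.
Fact qcounit_monoid : monoid_morphism qcounit.
Proof.
split; first by rewrite [LHS](qcounitE 1) rmorph1.
by elim/ex1=> a; elim/ex1=> b; rewrite -rmorphM /= !qcounitE rmorphM.
Qed.
HB.instance Definition _ := GRing.isLinear.Build k quot k^o _ qcounit qcounit_linear.
HB.instance Definition _ := GRing.isMonoidMorphism.Build quot k^o qcounit qcounit_monoid.

Fact qcounitl x : tlift (fun x y => (qcounit x : k) *: y) (qcomul x) = x.
Proof.
elim/ex1: x => a; rewrite qcomulE tlift_tmap.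
- rewrite -[in RHS](counitl a) linear_tlift; apply: eq_tlift => x y.
  by rewrite qcounitE linearZ.
- by move=> w c u v; rewrite linearP scalerDl scalerA.
- by move=> w c u v; rewrite scalerDr !scalerA mulrC.
Qed.

Fact qcounitr x : tlift (fun x y => (qcounit y : k) *: x) (qcomul x) = x.
Proof.
elim/ex1: x => a; rewrite qcomulE tlift_tmap.
- rewrite -[in RHS](counitr a) linear_tlift; apply: eq_tlift => x y.
  by rewrite qcounitE linearZ.
- by move=> w c u v; rewrite scalerDr !scalerA mulrC.
- by move=> w c u v; rewrite linearP scalerDl scalerA.
Qed.

(* The antipode preserves ker pi: the map x (x) y |-> x_1 (x) x_2 y of the      *)
(* quotient is surjective since the antipode of k[G] provides preimages, hence *)
(* it is injective, and it kills the image of a_1 (x) S(a_2) when pi a = 0.    *)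
Definition qgalois0 (y x1 x2 : quot) : tensor quot quot := tpure x1 (x2 * y).
Definition qgalois (T : tensor quot quot) : tensor quot quot :=
  tlift (fun x y => tlift (qgalois0 y) (qcomul x)) T.

Let qgalois0_linl y x2 : linear ((qgalois0 y)^~ x2).
Proof. exact: tpure_linl. Qed.
Let qgalois0_linr y x1 : linear (qgalois0 y x1).
Proof. by move=> c u v; rewrite /qgalois0 mulrDl -scalerAl tpure_linr. Qed.

Let qgalois_pure x y : qgalois (tpure x y) = tlift (qgalois0 y) (qcomul x).
Proof.
rewrite /qgalois tlift_pure //; first by move=> w c u v; rewrite !linearP.
move=> v; apply: tlift_linear_param => x1 x2 c u w.
by rewrite /qgalois0 mulrDr -scalerAr tpure_linr.
Qed.

Let qpre (a b : A) : tensor quot quot :=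
  tlift (fun x y => tpure (pi x) (pi (antipode G y) * pi b)) (comul G a).

Let qgalois_pre a b : qgalois (qpre a b) = tpure (pi a) (pi b).
Proof.
have lin_t : linear qgalois by move=> c u v; rewrite /qgalois linearP.
pose gal : {linear tensor quot quot -> tensor quot quot} :=
  HB.pack qgalois (GRing.isLinear.Build k _ _ _ _ lin_t).
pose t (x : A) (T : tensor A A) : tensor quot quot :=
  tpure (pi x) (pi (tlift (fun y z => y * antipode G z) T) * pi b).
have t_l T : linear (t^~ T) by move=> c u v; rewrite /t linearP tpure_linl.
have t_r x : linear (t x).
  by move=> c u v; rewrite /t !linearP mulrDl -scalerAl tpure_linr.
have b_l z : linear (fun y : A => y * antipode G z).
  by move=> c u v; rewrite mulrDl scalerAl.
have b_r y : linear (fun z : A => y * antipode G z).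
  by move=> c u v; rewrite linearP mulrDr scalerAr.
have E := congr1 (tlift t) (comulA a); rewrite !linear_tlift in E.
rewrite -[LHS]/(gal _) linear_tlift.
transitivity (tlift (fun x y => tlift t (tpure x (comul G y))) (comul G a)); last first.
  pose lb x : tensor quot quot := tpure (pi x) (pi b).
  have lb_lin : linear lb by move=> c u v; rewrite /lb linearP tpure_linl.
  pose L : {linear A -> tensor quot quot} := HB.pack lb (GRing.isLinear.Build k _ _ _ _ lb_lin).
  rewrite -[in RHS](counitr a) -[RHS]/(L _) linear_tlift; apply: eq_tlift => x y.
  rewrite [LHS]tlift_pure // linearZ /= /t /lb antipoder linearZ rmorph1 -scalerAl mul1r.
  by rewrite tpureZr.
rewrite {}E; apply: eq_tlift => x y; rewrite linear_tlift /= qgalois_pure qcomulE tlift_tmap //.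
apply: eq_tlift => x1 x2; rewrite [RHS]tlift_pure // /t tlift_pure // /qgalois0.
by rewrite rmorphM mulrA.
Qed.

Let qgalois_inj T : qgalois T = 0 -> T = 0.
Proof.
have lin_t : linear qgalois by move=> c u v; rewrite /qgalois linearP.
pose g := mklfun lin_t.
have gsurj : limg g = fullv.
  apply/vspaceP => T'; rewrite memvf -(tlift_tpure T') /tlift.
  apply: memv_suml => i _; apply: memv_suml => j _; rewrite memvZ //.
  have [a <-] := pi_surj (vbasis {:quot})`_i; have [b <-] := pi_surj (vbasis {:quot})`_j.
  by rewrite -qgalois_pre -(mklfunE lin_t) memv_img ?memvf.
have ginj : lker g == 0%VS.
  rewrite -dimv_eq0 -(eqn_add2r (\dim (limg g))) -(capfv (lker g)) limg_ker_dim.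
  by rewrite gsurj add0n.
move=> T0; apply: (lker0P ginj); rewrite linear0 mklfunE //.
Qed.

Lemma antipode_pi a : pi a = 0 -> pi (antipode G a) = 0.
Proof.
move=> a0; have : qpre a 1 = 0.
  apply: qgalois_inj; rewrite qgalois_pre a0.
  exact: tpure0l.
(* Applying the counit to the first factor turns [qpre a 1] into [pi (antipode G a)]. *)
move/(congr1 (tlift (fun x y => (qcounit x : k) *: y))); rewrite linear0 linear_tlift => E.
rewrite -[a](counitl a) linear_tlift linear_tlift -[RHS]E; apply: eq_tlift => x y.
rewrite [RHS]tlift_pure; first by rewrite qcounitE rmorph1 mulr1 !linearZ.
  by move=> w c u v; rewrite linearP scalerDl scalerA.
by move=> w c u v; rewrite scalerDr !scalerA mulrC.
Qed.

Definition qantipode (x : quot) : quot := pi (antipode G (sec x)).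
Fact qantipode_linear : linear qantipode.
Proof. by move=> c x y; rewrite /qantipode !linearP. Qed.
HB.instance Definition _ := GRing.isLinear.Build k quot quot _ qantipode qantipode_linear.
Lemma qantipodeE a : qantipode (pi a) = pi (antipode G a).
Proof. exact: (fact_pi (f := pi \o antipode G)) antipode_pi a. Qed.

Fact qantipodel x : tlift (fun x y => qantipode x * y) (qcomul x) = (qcounit x : k)%:A.
Proof.
elim/ex1: x => a; rewrite qcomulE tlift_tmap.
- rewrite qcounitE -(rmorph1 pi) -linearZ /= -antipodel linear_tlift.
  by apply: eq_tlift => x y; rewrite qantipodeE rmorphM.
- by move=> w c u v; rewrite linearP mulrDl scalerAl.
- by move=> w c u v; rewrite mulrDr scalerAr.
Qed.

Fact qantipoder x : tlift (fun x y => x * qantipode y) (qcomul x) = (qcounit x : k)%:A.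
Proof.
elim/ex1: x => a; rewrite qcomulE tlift_tmap.
- rewrite qcounitE -(rmorph1 pi) -linearZ /= -antipoder linear_tlift.
  by apply: eq_tlift => x y; rewrite qantipodeE rmorphM.
- by move=> w c u v; rewrite mulrDl scalerAl.
- by move=> w c u v; rewrite linearP mulrDr scalerAr.
Qed.

Definition quotScheme : finGroupScheme k :=
  @FinGroupScheme k quot qcomul qcounit qantipode quot_mulC qcomul1 qcomulM
    qcomulA qcounitl qcounitr qantipodel qantipoder.

Definition quotSubgroup : subgroupScheme G :=
  @SubgroupScheme k G quotScheme pi pi_surj qcomulE qcounitE.

Lemma quotSubgroupP u : u \in sbspace S <-> exists v : measures quotSubgroup, u = incl v.
Proof.
split=> [uS|[v ->]]; last first.
  by rewrite (_ : incl v = qfun v) ?qfun_mem //; apply: measP => a; rewrite inclE qfunE.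
pose f (x : quot) : k^o := \sum_i coord (vbasis S) i u * x 0 i.
have fl : linear f.
  move=> c x y; rewrite /f scaler_sumr -big_split; apply: eq_bigr => i _.
  by rewrite !mxE mulrDr mulrCA.
exists (mklfun fl : measures quotSubgroup); apply: measP => a.
rewrite inclE [RHS]mklfunE {1}(coord_vbasis uS) meas_fun_sum; apply: eq_bigr => i _.
by rewrite meas_scaleE mxE.
Qed.
End Quotient.

(** * Commutative local measure algebras *)

Section Derivations.
Variables (R : comNzRingType) (D : R -> R) (p : nat).
Hypotheses (DD : {morph D : x y / x + y}) (DM : forall x y, D (x * y) = D x * y + x * D y).
Hypothesis inv_lt : forall i, ~~ (p %| i)%N -> exists j : R, j * i%:R = 1.

Let D0 : D 0 = 0.
Proof. by apply: (addrI (D 0)); rewrite -DD !addr0. Qed.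

Lemma derivX (b : R) n : D (b ^+ n.+1) = n.+1%:R * b ^+ n * D b.
Proof.
elim: n => [|n IH]; first by rewrite expr1 expr0 !mul1r.
rewrite exprSr DM IH -[n.+2%:R]natr1 [b ^+ n.+1]exprSr; move: (b ^+ n) (n.+1%:R) => B m.
by ring.
Qed.

(** Apply D to b^(n+1) f = 0 and divide by the unit (n+1) D b. *)
Lemma deriv_pow_mul (b v f : R) n : ~~ (p %| n.+1)%N -> D b * v = 1 -> b ^+ n.+1 * f = 0 ->
  exists g, b ^+ n * f = b ^+ n.+1 * g.
Proof.
move=> /inv_lt[j jn] bv bf; have := congr1 D bf; rewrite D0 DM derivX exprSr.
move: (b ^+ n) (n.+1%:R) jn => B m jn E; exists (- (j * v * D f)).
have -> : B * f = (j * m) * (D b * v) * (B * f) by rewrite jn bv !mul1r.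
have -> : j * m * (D b * v) * (B * f) = j * v * (m * B * D b * f) by ring.
have -> : m * B * D b * f = - (B * b * D f) by apply/eqP; rewrite -addr_eq0 E.
by ring.
Qed.

Lemma deriv_exact (b v f : R) : prime p -> D b * v = 1 -> b * f = 0 ->
  exists g, f = b ^+ p.-1 * g.
Proof.
move=> p_pr bv bf; have pp : (p.-1 < p)%N by rewrite prednK ?prime_gt0.
elim: p.-1 pp => [|n IH] np; first by exists f; rewrite mul1r.
have [g fE] := IH (ltnW np).
have [||h hE] := @deriv_pow_mul b v g n _ bv.
- by rewrite gtnNdvd.
- by rewrite exprS -mulrA -fE.
by exists h; rewrite fE.
Qed.

(** By induction on m, whatever x^m kills is divisible by x. The derivation proves this when p does
    not divide m, and the second hypothesis supplies the multiples of p. Factors x are then split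
    off until the exponent reaches p N. *)
Lemma deriv_pow_exact (x v : R) N : D x * v = 1 ->
  (forall q f, (q < N)%N -> x ^+ (p * q) * f = 0 -> exists g, f = x * g) ->
  forall m f, (m <= p * N)%N -> x ^+ m * f = 0 -> exists g, f = x ^+ (p * N - m) * g.
Proof.
move=> xv xz.
have mul1 m : (m < p * N)%N -> forall f, x ^+ m * f = 0 -> exists g, f = x * g.
  elim: m => [|m IH] mN f.
    by rewrite mul1r => ->; exists 0; rewrite mulr0.
  have [/dvdnP[q mE]|pm] := boolP (p %| m.+1)%N.
    move=> xf; apply: (xz q); last by rewrite mulnC -mE.
    by rewrite -(ltn_pmul2l (m := p)) ?(mulnC p q) -?mE //; case: (p) mN.
  move=> xf; have [g gE] := deriv_pow_mul pm xv xf.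
  have [|h hE] := IH (ltnW mN) (f - x * g).
    by rewrite mulrBr gE exprSr mulrA subrr.
  by exists (h + g); rewrite mulrDr -hE subrK.
move=> m f mN; move dE: (p * N - m)%N => d.
elim: d m f mN dE => [|d IH] m f mN dE xf; first by exists f; rewrite mul1r.
have mN' : (m < p * N)%N by rewrite -subn_gt0 dE.
have [f' fE] := mul1 m mN' f xf.
have [|||g gE] := IH m.+1 f'; rewrite ?subnS ?dE //.
  by rewrite exprSr -mulrA -fE.
by exists g; rewrite fE gE exprS mulrA.
Qed.
End Derivations.

Section Augmentation.
Variables (k : fieldType) (U : finGroupScheme k).
Local Notation R := (measures U).

Lemma aug_mul (u v : R) : meas_fun (u * v) 1 = meas_fun u 1 * meas_fun v 1.
Proof. by rewrite [LHS]meas_mulE comul1 [LHS]evp_pure. Qed.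

Lemma aug_exp (u : R) n : meas_fun (u ^+ n) 1 = meas_fun u 1 ^+ n.
Proof. by elim: n => [|n IH]; rewrite ?meas_fun1 // !exprS aug_mul IH. Qed.

Definition augv : {vspace R} := lker (linfun (evm (1 : coordRing U))).
Lemma mem_augv u : (u \in augv) = (meas_fun u 1 == 0).
Proof. by rewrite memv_ker lfunE. Qed.

Definition augsq : {vspace R} := (augv * augv)%VS.

(** With m the augmentation ideal, x spans m/m^2, which may be zero. *)
Definition aug_gen1 (x : R) :=
  meas_fun x 1 = 0 /\ forall y, meas_fun y 1 = 0 -> exists c, y - c *: x \in augsq.
Definition aug_indep (x1 x2 : R) :=
  [/\ meas_fun x1 1 = 0, meas_fun x2 1 = 0 &
      forall s t, s *: x1 + t *: x2 \in augsq -> s = 0 /\ t = 0].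

Lemma mem_augsq u v : meas_fun u 1 = 0 -> meas_fun v 1 = 0 -> u * v \in augsq.
Proof. by move=> u0 v0; rewrite memv_mul // mem_augv ?u0 ?v0. Qed.

Lemma aug_indepP x1 x2 : meas_fun x1 1 = 0 -> meas_fun x2 1 = 0 -> x1 \notin augsq ->
  (forall c, x2 - c *: x1 \notin augsq) -> aug_indep x1 x2.
Proof.
move=> a1 a2 x1M x2M; split=> // s t; have [->|t0] := eqVneq t 0.
  rewrite scale0r addr0; have [->|s0] := eqVneq s 0; first by [].
  by rewrite rpredZeq (negPf s0) (negPf x1M).
move=> stM; have := x2M (- (t^-1 * s)); rewrite scaleNr opprK => /negP[].
have -> : x2 + (t^-1 * s) *: x1 = t^-1 *: (s *: x1 + t *: x2).
  by rewrite scalerDr !scalerA mulVf // scale1r addrC.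
by rewrite memvZ.
Qed.

Lemma aug_gen_or_indep : (exists x, aug_gen1 x) \/ (exists x1 x2, aug_indep x1 x2).
Proof.
have [|nogen] := EM (exists x, aug_gen1 x); first by left.
have ex x : meas_fun x 1 = 0 -> exists2 y, meas_fun y 1 = 0 & forall c, y - c *: x \notin augsq.
  move=> x0; apply/not_exists2P => h; apply: nogen; exists x; split=> // y y0.
  have [//|/existsNP[c /negP]] := h y; rewrite negbK => yM; by exists c.
have [x1 x10 x1M] := ex 0 (meas_fun0 _); have [x2 x20 x2M] := ex x1 x10.
right; exists x1, x2; apply: aug_indepP => //.
by have := x1M 0; rewrite scale0r subr0.
Qed.
End Augmentation.

Section LocalAlgebra.
Variables (k : fieldType) (p : nat) (char_k : p \in [pchar k]).
Variable U : finGroupScheme k.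
Local Notation R := (measures U).
Hypotheses (cU : forall u v : R, u * v = v * u).
Hypothesis nil : forall x : R, meas_fun x 1 = 0 -> exists n, x ^+ n = 0.

Let p_pr : prime p := pcharf_prime char_k.
Let p_gt0 := prime_gt0 p_pr.
Let p_gt1 := prime_gt1 p_pr.

Lemma pchar_measures : p \in [pchar R].
Proof.
rewrite inE p_pr /=; apply/eqP; rewrite -[1](scale1r 1) -scaler_nat scalerA.
by rewrite (pcharf0 char_k) mul0r scale0r.
Qed.

Lemma frobD (x y : R) : (x + y) ^+ p = x ^+ p + y ^+ p.
Proof. exact: (pFrobenius_autD_comm pchar_measures (cU x y)). Qed.

Lemma frobN (x : R) : (- x) ^+ p = - x ^+ p.
Proof. exact: (pFrobenius_autN pchar_measures). Qed.

Lemma exprM_meas (x y : R) n : (x * y) ^+ n = x ^+ n * y ^+ n.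
Proof. exact/exprMn_comm/cU. Qed.

Lemma mCA (u v w : R) : u * (v * w) = v * (u * w).
Proof. by rewrite !mulrA (cU u). Qed.

Lemma frobD_iter n (x y : R) : (x + y) ^+ (p ^ n) = x ^+ (p ^ n) + y ^+ (p ^ n).
Proof. by elim: n => [|n IH]; rewrite ?expr1 // expnSr !exprM IH frobD. Qed.

(** [v] is a nonzero scalar plus a nilpotent element, so some p^n-th power of it is a nonzero
    scalar. *)
Lemma aug_unit (v : R) : meas_fun v 1 != 0 -> exists w, v * w = 1.
Proof.
move=> v0; set c := meas_fun v 1.
have [n nE] : exists n, (v - (c : k)%:A) ^+ n = 0.
  apply: nil; rewrite -scaleN1r meas_addE !meas_scaleE meas_fun1 mulr1 mulN1r subrr //.
have vE : v ^+ (p ^ n) = ((c : k) ^+ (p ^ n))%:A.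
  rewrite -[v](subrK ((c : k)%:A)) frobD_iter.
  rewrite (_ : (v - _) ^+ (p ^ n) = 0); last first.
    by rewrite -(subnK (ltnW (ltn_expl n p_gt1))) exprD nE mulr0.
  by rewrite add0r exprZn expr1n.
exists (((c : k) ^- (p ^ n)) *: v ^+ (p ^ n).-1).
rewrite -scalerAr -exprS prednK ?expn_gt0 ?p_gt0 // vE scalerA mulVf ?scale1r //.
by rewrite expf_neq0.
Qed.

(** Otherwise take an ideal I containing x, properly contained in m and of largest dimension. For z
    in m, I + z m is I or m; the latter yields m = I + z^j m for all j, hence m = I as z is
    nilpotent. So m^2 lies in I, and with x this gives m = I. *)
Lemma aug_nakayama (x : R) : aug_gen1 x -> forall y, meas_fun y 1 = 0 -> exists r, y = x * r.
Proof.
move=> [x0 gen] y y0; apply: contrapT => yx.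
pose P (I : {vspace R}) := [/\ (forall r i, i \in I -> r * i \in I), x \in I,
  (I <= augv U)%VS & ~ (augv U <= I)%VS].
have memx z : z \in limg (amull x) <-> exists r, z = x * r.
  split=> [/memv_imgP[r _ ->]|[r ->]]; first by exists r; rewrite amullE.
  by rewrite -amullE memv_img ?memvf.
have [|I [Iid xI Iaug Ipr] Imax] := @ex_max_vspace k R P (limg (amull x)).
  split=> [r i /memx[s ->]| | |].
  - by rewrite mCA; apply/memx; exists (r * s).
  - by apply/memx; exists 1; rewrite mulr1.
  - by apply/subvP => _ /memx[r ->]; rewrite mem_augv aug_mul x0 mul0r.
  - by move=> /subvP /(_ y); rewrite mem_augv y0 eqxx => /(_ isT) /memx.
have yI (z w : R) : meas_fun z 1 = 0 -> meas_fun w 1 = 0 -> z * w \in I.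
  move=> z0 w0; pose I' := (I + amull z @: augv U)%VS.
  have I'aug : (I' <= augv U)%VS.
    rewrite subv_add Iaug; apply/subvP => _ /memv_imgP[u _ ->].
    by rewrite amullE mem_augv aug_mul z0 mul0r.
  have I'id r i : i \in I' -> r * i \in I'.
    move=> /memv_addP[a aI [_ /memv_imgP[b bA ->] ->]].
    rewrite amullE mulrDr mCA -(amullE z) memv_add ?Iid ?memv_img //.
    by move: bA; rewrite !mem_augv aug_mul => /eqP ->; rewrite mulr0.
  have [full|nfull] := pselect (augv U <= I')%VS; last first.
    have : (\dim I' <= \dim I)%N by apply: Imax; split=> //; rewrite (subvP (addvSl _ _)).
    move=> le; have : (\dim I == \dim I')%N by rewrite eqn_leq le dimvS ?addvSl.
    rewrite dimv_leqif_eq ?addvSl // => /eqP ->.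
    by rewrite (subvP (addvSr _ _)) // -amullE memv_img // mem_augv w0.
  case: Ipr; have [n zn] := nil z0; apply/subvP => u.
  have dec j : u \in augv U -> exists i w, [/\ i \in I, w \in augv U & u = i + z ^+ j * w].
    move=> uA; elim: j => [|j [i [v [iI vA ->]]]].
      by exists 0, u; rewrite mem0v uA add0r mul1r.
    have /memv_addP[a aI [_ /memv_imgP[b bA ->] ->]] := subvP full _ vA.
    exists (i + z ^+ j * a), b; split=> //; first by rewrite memvD ?Iid.
    by rewrite amullE mulrDr addrA exprSr mulrA.
  by move=> /(dec n)[i [v [iI _ ->]]]; rewrite zn mul0r addr0.
apply: Ipr; apply/subvP => z; rewrite mem_augv => /eqP /gen[c zM].
rewrite -(subrK (c *: x) z) memvD ?memvZ //; apply: subvP zM.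
apply/prodvP => u v; rewrite !mem_augv => /eqP u0 /eqP v0; exact: yI.
Qed.

Lemma aug_chain (x : R) : aug_gen1 x -> forall y, y = 0 \/
  exists i v, y = x ^+ i * v /\ meas_fun v 1 != 0.
Proof.
move=> gx y; have nak := aug_nakayama gx; have [n xn] := nil gx.1.
have [|[w]] : (exists i v, y = x ^+ i * v /\ meas_fun v 1 != 0) \/ exists w, y = x ^+ n * w.
- elim: (n) => [|j [?|[w yE]]]; [by right; exists y; rewrite mul1r|by left|].
  have [/nak[r wE]|w0] := eqVneq (meas_fun w 1) 0; last by left; exists j, w.
  by right; exists r; rewrite yE wE exprSr mulrA.
- by right.
by rewrite xn mul0r => ->; left.
Qed.

Lemma aug_chain_dvd (x b b' : R) : aug_gen1 x ->
  (exists c, b' = b * c) \/ (exists c, b = b' * c).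
Proof.
move=> gx; have [->|[i [v [-> v0]]]] := aug_chain gx b.
  by right; exists 0; rewrite mulr0.
have [->|[j [w [-> w0]]]] := aug_chain gx b'; first by left; exists 0; rewrite mulr0.
have [[v' vv'] [w' ww']] := (aug_unit v0, aug_unit w0).
have [ij|/ltnW ij] := leqP i j; [left; exists (x ^+ (j - i) * (v' * w)) |
  right; exists (x ^+ (i - j) * (w' * v))].
  rewrite -{1}(subnKC ij) exprD -!mulrA; congr (_ * _).
  by rewrite [RHS]mCA; congr (_ * _); rewrite mulrA vv' mul1r.
rewrite -{1}(subnKC ij) exprD -!mulrA; congr (_ * _).
by rewrite [RHS]mCA; congr (_ * _); rewrite mulrA ww' mul1r.
Qed.

(** If c were nilpotent, any y with b y = 0 would lie in the image of (b c)^(p-1), so y = c y1 with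
    b y1 = 0. Iteration gives y = 0, so b is injective, against b^p = 0. *)
Lemma exactp_factor_unit (b c : R) : b ^+ p = 0 -> exactp (amull (b * c)) p ->
  meas_fun c 1 != 0.
Proof.
move=> bp ex; apply/eqP => c0; have [n cn] := nil c0.
have down y : b * y = 0 -> exists2 y1, y = c * y1 & b * y1 = 0.
  move=> by0; have [|z] := ex y; first by rewrite amullE -mulrA mCA by0 mulr0.
  rewrite iter_amull exprM_meas => ->; exists (b ^+ p.-1 * (c ^+ p.-2 * z)).
    rewrite mCA -mulrA; congr (_ * _); rewrite mulrA -exprS prednK //.
    by rewrite -ltnS prednK.
  by rewrite mulrA -exprS prednK // bp mul0r.
have inj y : b * y = 0 -> y = 0.
  move=> by0; suff [z ->] : exists2 z, y = c ^+ n * z & b * z = 0 by rewrite cn mul0r.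
  elim: (n) => [|j [z -> /down[z' -> bz']]]; first by exists y; rewrite ?mul1r.
  by exists z'; rewrite // exprSr mulrA.
suff: (1 : R) = 0 by move/eqP; rewrite oner_eq0.
have : b ^+ p * 1 = 0 by rewrite bp mul0r.
by elim: (p) => [|j IH]; rewrite ?mul1r // exprS -mulrA => /inj.
Qed.
End LocalAlgebra.

Section FrobeniusSum.
Variables (k : fieldType) (p : nat) (char_k : p \in [pchar k]) (C : algType k).
Hypothesis cC : forall x y : C, x * y = y * x.

Lemma sum_exp_pchar I (r : seq I) (P : pred I) (F : I -> C) :
  (\sum_(i <- r | P i) F i) ^+ p = \sum_(i <- r | P i) F i ^+ p.
Proof.
have pC : p \in [pchar C].
  rewrite inE (pcharf_prime char_k) /=; apply/eqP.
  by rewrite -[1](scale1r 1) -scaler_nat scalerA (pcharf0 char_k) mul0r scale0r.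
apply: (big_morph (fun x : C => x ^+ p)) => [x y|].
  exact: (pFrobenius_autD_comm pC (cC x y)).
by rewrite expr0n gtn_eqF // prime_gt0 // (pcharf_prime char_k).
Qed.
End FrobeniusSum.

(** * The subgroup attached to p-th powers *)

Section FrobeniusImage.
Variables (k : closedFieldType) (p : nat) (char_k : p \in [pchar k]).
Variable U : finGroupScheme k.
Local Notation R := (measures U).
Local Notation A := (coordRing U).
Hypotheses (cU : forall u v : R, u * v = v * u).

Let p_pr : prime p := pcharf_prime char_k.

Lemma closed_proot (c : k) : exists d, d ^+ p = c.
Proof.
have [|d] := closed_rootP ('X^p - c%:P) _.
  by rewrite size_XnsubC ?prime_gt0 // eqSS -lt0n prime_gt0.
by rewrite rootE !hornerE subr_eq0 => /eqP; exists d.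
Qed.

Let ev0 a b (u v : R) : k^o := meas_fun u a * meas_fun v b.
Let ev a b (T : tprod R R) : k^o := tlift (ev0 a b) T.
Let ev0_l a b v : linear ((ev0 a b)^~ v).
Proof. by move=> c x y; rewrite /ev0 meas_addE meas_scaleE mulrDl -mulrA. Qed.
Let ev0_r a b u : linear (ev0 a b u).
Proof. by move=> c x y; rewrite /ev0 meas_addE meas_scaleE mulrDr mulrCA. Qed.
Let ev_lin a b : linear (ev a b).
Proof. by move=> c x y; rewrite /ev linearP. Qed.
Let ev_pure a b u v : ev a b (tpure u v) = meas_fun u a * meas_fun v b.
Proof. by rewrite /ev tlift_pure. Qed.

(* T represents the coproduct of r.                                           *)
Let rep (r : R) (T : tprod R R) := forall a b, ev a b T = meas_fun r (a * b).

Let ev_mul a b T T' : ev a b (T * T') =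
  tlift (fun x y => tlift (fun x' y' => ev x x' T * ev y y' T' : k^o) (comul U b)) (comul U a).
Proof.
move: T; apply: tensor_ext => [c X Y|c X Y|u v].
- transitivity (ev a b (c *: ((X : tprod R R) * T') + (Y : tprod R R) * T')); last exact: ev_lin.
  by congr (ev a b _); apply: tmul_linl.
- apply: (@tlift_linear_param k A A (tprod R R) k^o (fun T x y =>
    tlift (fun x' y' => ev x x' T * ev y y' T' : k^o) (comul U b))) => x y.
  apply: tlift_linear_param => x' y' c' X' Y'.
  by rewrite ev_lin mulrDl -mulrA.
move: T'; apply: tensor_ext => [c X Y|c X Y|u' v'].
- pose W : tprod R R := tpure u v.
  transitivity (ev a b (c *: (W * X) + W * Y)); last exact: ev_lin.
  by congr (ev a b _); apply: tmul_linr.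
- apply: (@tlift_linear_param k A A (tprod R R) k^o (fun T x y =>
    tlift (fun x' y' => ev x x' (tpure u v) * ev y y' T : k^o) (comul U b))) => x y.
  apply: tlift_linear_param => x' y' c' X' Y'.
  by rewrite ev_lin mulrDr mulrCA.
rewrite [_ * _]tmul_pure ev_pure !meas_mulE mulrC mulr_tlift; apply: eq_tlift => x y.
rewrite mulrC mulr_tlift; apply: eq_tlift => x' y'; rewrite !ev_pure.
by rewrite mulrACA.
Qed.

Let rep_mul r r' T T' : rep r T -> rep r' T' -> rep (r * r') (T * T').
Proof.
move=> rT rT' a b; rewrite ev_mul [RHS]meas_mulE comulM linear_tlift.
apply: eq_tlift => x y; rewrite linear_tlift; apply: eq_tlift => x' y'.
by rewrite rT rT' [RHS]evp_pure.
Qed.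

Let rep_exp r T n : rep r T -> rep (r ^+ n) (T ^+ n).
Proof.
move=> rT; elim: n => [|n IH]; last by rewrite !exprS; apply: rep_mul.
move=> a b; rewrite [LHS]ev_pure ![meas_fun 1 _]meas_oneE rmorphM //.
Qed.

(** The coproduct is multiplicative, so the p-th power of [T] represents r^p and is the sum of the
    p-th powers of its terms. Contracting with a leaves scalar coefficients, which have p-th roots
    in k. *)
Lemma Dm_frob (a : A) (r : R) : exists s, Dm a (r ^+ p) = s ^+ p.
Proof.
pose e := vbasis {:A}.
pose T : tprod R R := \sum_(i < \dim {:A}) tpure (Dm e`_i r) (mcoord e i).
have rT : rep r T.
  move=> f b; rewrite /ev linear_sum [f * b]coordRing_mulC [b in RHS](coord_vbasis (memvf b)).
  rewrite mulr_suml linear_sum; apply: eq_bigr => i _.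
  by rewrite [LHS]ev_pure DmE mcoordE -scalerAl linearZ /= mulrC.
have := rep_exp p rT; rewrite (sum_exp_pchar char_k (tprod_mulC cU cU)).
have pureX n (u v : R) : (tpure u v : tprod R R) ^+ n = tpure (u ^+ n) (v ^+ n).
  by elim: n => [|n IH]; rewrite // !exprS IH [LHS]tmul_pure.
under eq_bigr do rewrite pureX.
move=> rTp.
have rootE i : exists d : k, d ^+ p = meas_fun (mcoord e i ^+ p) a by apply: closed_proot.
have /choice[d dE] := rootE.
exists (\sum_i d i *: Dm e`_i r); rewrite (sum_exp_pchar char_k cU).
apply: measP => f; rewrite DmE coordRing_mulC -rTp /ev linear_sum meas_fun_sum.
by apply: eq_bigr => i _; rewrite [LHS]ev_pure exprZn meas_scaleE dE mulrC.
Qed.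

(** The corresponding subgroup is the image of the Verschiebung of U, Cartier dual to Frobenius. *)
Lemma ex_frob_bialg : exists S : subBialg U, forall y, y \in sbspace S <-> exists r, y = r ^+ p.
Proof.
have [|c x y [r ->] [s ->]|F FP] := @ex_vspace k R (fun y => exists r, y = r ^+ p).
- by exists 0; rewrite expr0n gtn_eqF ?prime_gt0.
- have [d <-] := closed_proot c; exists (d *: r + s).
  by rewrite (frobD char_k cU) exprZn.
have F1 : 1 \in F by apply/FP; exists 1; rewrite expr1n.
have FM u v : u \in F -> v \in F -> u * v \in F.
  move=> /FP[r ->] /FP[s ->]; apply/FP; exists (r * s).
  by rewrite (exprM_meas cU).
have FD a u : u \in F -> Dm a u \in F.
  by move=> /FP[r ->]; apply/FP; apply: Dm_frob.
by exists (SubBialg F1 FM FD).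
Qed.
End FrobeniusImage.

Section Primitive.
Variables (k : fieldType) (U : finGroupScheme k).
Local Notation R := (measures U).
Local Notation A := (coordRing U).

(** A linear form on m/m^2 that separates x from y, extended by 0 on constants and realised as a
    function. *)
Lemma ex_primitive (x y : R) : aug_indep x y -> exists a : A,
  [/\ meas_fun x a = 1, meas_fun y a = 0, meas_fun (1 : R) a = 0 &
      forall u : R, u \in augsq U -> meas_fun u a = 0].
Proof.
move=> [x0 y0 ind]; pose W := (augsq U + <[1]> + <[y]>)%VS.
have xW : x \notin W.
  apply/negP => /memv_addP[_ /memv_addP[m mM [_ /vlineP[c ->] ->]] [_ /vlineP[t ->] xE]].
  have c0 : c = 0.
    have := congr1 (fun u : R => meas_fun u 1) xE.
    rewrite !meas_addE !meas_scaleE x0 y0 meas_fun1 mulr1 mulr0 addr0.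
    suff -> : meas_fun m 1 = 0 by rewrite add0r => ->.
    apply/eqP; rewrite -mem_augv; apply: subvP mM.
    by apply/prodvP => u v; rewrite !mem_augv aug_mul => /eqP -> _; rewrite mul0r.
  have [] := ind 1 (- t).
    by rewrite scale1r scaleNr xE c0 scale0r addr0 addrK.
  by move/eqP; rewrite oner_eq0.
have [phi phix phiW] := separate xW; have [a aE] := meas_reflexive phi.
have subW z : z \in W -> meas_fun z a = 0 by move=> /phiW <-; rewrite aE.
exists a; split=> [||| u uM]; rewrite -?aE //.
- by apply: phiW; rewrite (subvP (addvSr _ _)) ?memv_line.
- by apply: phiW; rewrite (subvP (addvSl _ _)) ?(subvP (addvSr _ _)) ?memv_line.
- by apply: phiW; rewrite (subvP (addvSl _ _)) ?(subvP (addvSl _ _)).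
Qed.

(** Vanishing on 1 and on m^2 makes evaluation at a a derivation along the augmentation. Hence the
    coproduct of a is a (x) 1 + 1 (x) a, and [DmM] becomes the Leibniz rule. *)
Lemma primitive_deriv (a : A) : meas_fun (1 : R) a = 0 ->
  (forall u : R, u \in augsq U -> meas_fun u a = 0) ->
  forall u v, Dm a (u * v) = Dm a u * v + u * Dm a v.
Proof.
move=> a1 aM.
have am u v : meas_fun (u * v) a = meas_fun u a * meas_fun v 1 + meas_fun u 1 * meas_fun v a.
  set c : k := meas_fun u 1; set d : k := meas_fun v 1.
  have aug0 (w : R) : meas_fun (w - (meas_fun w 1 : k)%:A) 1 = 0.
    by rewrite -scaleN1r meas_addE !meas_scaleE meas_fun1 mulr1 mulN1r subrr.
  have := aM _ (mem_augsq (aug0 u) (aug0 v)); rewrite -/c -/d.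
  have -> : (u - c%:A) * (v - d%:A) = u * v - d *: u - c *: v + (c * d)%:A.
    rewrite mulrBl !mulrBr -!scalerAr -!scalerAl mulr1 mul1r opprB scalerA mulr1.
    by rewrite addrA addrAC [d * c]mulrC.
  rewrite -!scaleNr !meas_addE !meas_scaleE a1 mulr0 addr0 !mulNr.
  move/eqP; rewrite subr_eq add0r subr_eq => /eqP ->.
  by rewrite addrC [d * _]mulrC.
have Da : comul U a = tpure a 1 + tpure 1 a.
  apply/eqP; rewrite -subr_eq0; apply/eqP/tensor_eq0 => u v.
  rewrite linearB linearD /= !evp_pure.
  have -> : tlift (evp u v) (comul U a) = meas_fun (u * v) a by rewrite [RHS]meas_mulE.
  by rewrite am subrr.
move=> u v; rewrite DmM Da linearD /=.
have D1 w : Dm 1 w = w by apply: measP => f; rewrite DmE mul1r.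
rewrite !tlift_pure ?D1 //.
- by move=> w c x y; rewrite Dm_linearl mulrDl scalerAl.
- by move=> w c x y; rewrite Dm_linearl mulrDr scalerAr.
- by move=> w c x y; rewrite Dm_linearl mulrDl scalerAl.
- by move=> w c x y; rewrite Dm_linearl mulrDr scalerAr.
Qed.
End Primitive.

(** * Construction of a pencil of exact elements *)

Section TwoExact.
Variables (k : closedFieldType) (p : nat) (char_k : p \in [pchar k]).
Let p_pr : prime p := pcharf_prime char_k.
Let p_gt0 := prime_gt0 p_pr.
Let p_gt1 := prime_gt1 p_pr.

Definition exact_pencil (U : finGroupScheme k) (b1 b2 : measures U) :=
  [/\ b1 ^+ p = 0, b2 ^+ p = 0 & forall s t : k, (s != 0) || (t != 0) ->
      exactp (amull (s *: b1 + t *: b2)) p].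

Section Explicit.
Variable U : finGroupScheme k.
Local Notation R := (measures U).
Hypotheses (cU : forall u v : R, u * v = v * u).
Hypothesis nil : forall x : R, meas_fun x 1 = 0 -> exists n, x ^+ n = 0.

Let Rc : comNzRingType :=
  HB.pack (measures U) (GRing.PzRing_hasCommutativeMul.Build (measures U) cU).

Let inv_lt i : ~~ (p %| i)%N -> exists j : R, j * i%:R = 1.
Proof.
move=> pi; have i0 : i%:R != 0 :> k by rewrite -(dvdn_pcharf char_k).
exists ((i%:R : k)^-1)%:A; rewrite -[i%:R in LHS](mulr1n) -scaler_nat.
by rewrite -scalerAl mul1r scalerA mulVf // scale1r.
Qed.

(** For t = 0, a derivation with D x a unit applies: [deriv_pow_exact] with m = N puts the
    annihilator of x^N in x^(pN-N) R, the image of (x^N)^(p-1). For t != 0, a derivation dual to y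
    makes D b a unit and [deriv_exact] suffices. *)
Lemma explicit_pencil (x y : R) N : aug_indep x y -> y ^+ p = 0 -> (0 < N)%N ->
  x ^+ (p * N) = 0 ->
  (forall q f, (q < N)%N -> x ^+ (p * q) * f = 0 -> exists g, f = x * g) ->
  exact_pencil (x ^+ N) y.
Proof.
move=> ind yp N0 xpN xz.
have [x0 y0 ind0] := ind.
have xNp : (x ^+ N) ^+ p = 0 by rewrite -exprM mulnC.
split=> // s t st; have [t0|t0] := eqVneq t 0.
  have s0 : s != 0 by move: st; rewrite t0 eqxx orbF.
  have [a [xa _ a1 aM]] := ex_primitive ind.
  have [|v xv] := aug_unit char_k cU nil (v := Dm a x).
    by rewrite DmE mulr1 xa oner_eq0.
  move=> f; rewrite t0 scale0r addr0 amullE -scalerAl => /eqP.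
  rewrite scaler_eq0 (negPf s0) => /eqP xf.
  have [g fE] := @deriv_pow_exact Rc (Dm a) p (linearD _) (primitive_deriv a1 aM) inv_lt
    x v N xv xz N f (leq_pmull N p_gt0) xf.
  exists ((s ^- p.-1) *: g); rewrite iter_amull exprZn -scalerAr -scalerAl scalerA.
  rewrite mulVf ?expf_neq0 // scale1r -exprM [LHS]fE; congr (x ^+ _ * g).
  by rewrite -{2}[N]mul1n -mulnBl subn1 mulnC.
have ind' : aug_indep y x.
  by split=> // s' t'; rewrite addrC => /ind0[].
have [a [ya xa a1 aM]] := ex_primitive ind'.
set b := s *: _ + _; have ba : meas_fun b a = t.
  rewrite /b meas_addE !meas_scaleE ya mulr1 (_ : meas_fun (x ^+ N) a = 0) ?mulr0 ?add0r //.
  (* For N = 1 the function a vanishes on x by choice; for N > 1 the power lies in m^2. *)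
  case: (N) N0 => // -[|n] _; first by rewrite expr1.
  by apply: aM; rewrite exprS mem_augsq // aug_exp x0 expr0n.
have [|v bv] := aug_unit char_k cU nil (v := Dm a b).
  by rewrite DmE mulr1 ba.
move=> f; rewrite amullE => bf.
have [g fE] := @deriv_exact Rc (Dm a) p (linearD _) (primitive_deriv a1 aM) inv_lt
  b v f p_pr bv bf.
by exists g; rewrite iter_amull.
Qed.
End Explicit.

(** If x1 and x2 both lay in k x + m^2, they would be dependent modulo m^2. *)
Lemma indep_avoid (U : finGroupScheme k) (x x1 x2 : measures U) : aug_indep x1 x2 ->
  meas_fun x 1 = 0 -> x \notin augsq U -> exists2 y, meas_fun y 1 = 0 &
  forall c, y - c *: x \notin augsq U.
Proof.
move=> [x10 x20 ind] x0 xM.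
have [[c1 x1M]|h] := pselect (exists c, x1 - c *: x \in augsq U); last first.
  by exists x1 => // c; apply/negP => xM'; apply: h; exists c.
exists x2 => // c2; apply/negP => x2M.
have [] := ind c2 (- c1).
  have -> : c2 *: x1 + - c1 *: x2 = c2 *: (x1 - c1 *: x) - c1 *: (x2 - c2 *: x).
    by rewrite !scalerBr !scalerA [c2 * c1]mulrC opprB scaleNr addrA subrK.
  by rewrite memvB ?memvZ.
move=> c20 /eqP; rewrite oppr_eq0 => /eqP c10.
have := ind 1 0; rewrite scale1r scale0r addr0.
move: x1M; rewrite c10 scale0r subr0 => x1M /(_ x1M)[/eqP].
by rewrite oner_eq0.
Qed.

(* If the algebra of p-th powers again needs two generators, we pass to it.   *)
(* Otherwise its augmentation ideal is generated by some x^p, so a second     *)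
(* generator y can be corrected to y - xw with (y - xw)^p = 0, and the pencil *)
(* is spanned by y - xw and x^N, with N the nilpotency index of x^p.          *)
Theorem ex_exact_pencil (U : finGroupScheme k) :
  (forall u v : measures U, u * v = v * u) ->
  (forall x : measures U, meas_fun x 1 = 0 -> exists n, x ^+ n = 0) ->
  (exists x1 x2 : measures U, aug_indep x1 x2) ->
  exists b1 b2 : measures U, exact_pencil b1 b2.
Proof.
move: {2}(\dim {:measures U}).+1 (ltnSn (\dim {:measures U})) => n.
elim: n U => // n IH U dU cU nil [x1 [x2 ind]].
have [S SP] := ex_frob_bialg char_k cU.
pose X := quotSubgroup S.
have inclX y : (exists v : measures X, y = incl v) <-> exists r, y = r ^+ p.
  by split=> [/quotSubgroupP/SP|/SP/quotSubgroupP].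
have cX (u v : measures X) : u * v = v * u.
  by apply: (@incl_inj k U X); rewrite !rmorphM /= cU.
have nilX (x : measures X) : meas_fun x 1 = 0 -> exists n, x ^+ n = 0.
  rewrite -incl1E => /nil[m xm]; exists m; apply: (@incl_inj k U X).
  by rewrite rmorphXn linear0.
have uX : unipotent X by apply: nil_unipotent.
have rp0 (r : measures U) : meas_fun (r ^+ p) 1 = 0 -> meas_fun r 1 = 0.
  by rewrite aug_exp => /eqP; rewrite expf_eq0 => /andP[_ /eqP].
have [x10 x20 ind0] := ind.
have x1M : x1 \notin augsq U.
  apply/negP => x1M; have [] := ind0 1 0; first by rewrite scale1r scale0r addr0.
  by move/eqP; rewrite oner_eq0.
have [[z' genz]|indX] := @aug_gen_or_indep k X; last first.
  (* A p-th power of an element of m lies in m^2, so x1 is not a p-th power and kX is strictly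
     smaller than kU. *)
  have dX : (\dim {:measures X} < n)%N.
    rewrite (leq_trans _ (dU : _ <= n)%N) //.
    have inj : lker (linfun (@incl k U X)) == 0%VS.
      by apply/lker0P => u v; rewrite !lfunE => /incl_inj.
    rewrite -(limg_dim_eq (f := linfun (@incl k U X))) ?(eqP inj) ?capv0 //.
    rewrite ltn_neqAle dimvS ?subvf // andbT dimv_leqif_eq ?subvf //.
    apply/eqP => full; have : x1 \in limg (linfun (@incl k U X)) by rewrite full memvf.
    move=> /memv_imgP[v _]; rewrite lfunE /= => x1E.
    have [|r rE] := (inclX x1).1; first by exists v.
    have r0 : meas_fun r 1 = 0 by apply: rp0; rewrite -rE.
    move: x1M; rewrite rE -(prednK p_gt0) exprS mem_augsq // aug_exp r0.
    by rewrite expr0n gtn_eqF // -ltnS prednK.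
  have [b1 [b2 [b1p b2p bex]]] := IH X dX cX nilX indX.
  exists (incl b1), (incl b2); split=> [||s t st].
  - by rewrite -rmorphXn b1p rmorph0.
  - by rewrite -rmorphXn b2p rmorph0.
  - by rewrite -!linearZ -linearD; apply: incl_exactp => //; apply: bex.
have nakX := aug_nakayama cX nilX genz.
have [x zE] : exists x, incl z' = x ^+ p by apply/inclX; exists z'.
have x0 : meas_fun x 1 = 0 by apply: rp0; rewrite -zE incl1E genz.1.
have powE (y : measures U) : meas_fun y 1 = 0 -> exists w, y ^+ p = x ^+ p * w ^+ p.
  move=> y0; have [|v vE] := (inclX (y ^+ p)).2; first by exists y.
  have [|r rE] := nakX v; first by rewrite -incl1E -vE aug_exp y0 expr0n gtn_eqF.
  have [w wE] : exists w, incl r = w ^+ p by apply/inclX; exists r.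
  by exists w; rewrite vE rE rmorphM /= zE wE.
(* If x is in m^2, then x^p = x^(2p) v by additivity of p-th powers, so x^p = 0 because 1 - x^p v is
   a unit. Then all p-th powers of elements of m vanish, and x1, x2 work with N = 1. *)
have [xM|xM] := boolP (x \in augsq U).
  have xp : x ^+ p = 0.
    pose P (u : measures U) := exists v, u ^+ p = x ^+ p * x ^+ p * v.
    have [|c u v [u' uE] [v' vE]|T TP] := @ex_vspace k (measures U) P.
    - by exists 0; rewrite mulr0 expr0n gtn_eqF.
    - exists (c ^+ p *: u' + v'); rewrite (frobD char_k cU) exprZn uE vE mulrDr.
      by rewrite scalerAr.
    have /TP[v xv] : x \in T.
      apply: subvP xM; apply/prodvP => u v; rewrite !mem_augv => /eqP u0 /eqP v0.
      have [[u' uE] [v' vE]] := (powE u u0, powE v v0); apply/TP; exists (u' ^+ p * v' ^+ p).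
      by rewrite (exprM_meas cU) uE vE -!mulrA; congr (_ * _); rewrite (mCA cU).
    have [|w ww] := aug_unit char_k cU nil (v := 1 - x ^+ p * v).
      rewrite -scaleN1r meas_addE meas_scaleE meas_fun1 aug_mul aug_exp x0 expr0n.
      by rewrite gtn_eqF // mul0r mulr0 addr0 oner_eq0.
    rewrite -[LHS]mulr1 -ww mulrA mulrBr mulr1 mulrA {1}xv subrr mul0r //.
  exists (x1 ^+ 1), x2; apply: explicit_pencil => //.
  - by have [w ->] := powE x2 x20; rewrite xp mul0r.
  - by rewrite muln1; have [w ->] := powE x1 x10; rewrite xp mul0r.
  - by move=> [|q] f // _; rewrite muln0 mul1r => ->; exists 0; rewrite mulr0.
have [y y0 yM] := indep_avoid ind x0 xM.
have [w wE] := powE y y0.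
have exN : exists m, z' ^+ m == 0 by have [m zm] := nilX z' genz.1; exists m; apply/eqP.
case: (ex_minnP exN) => N /eqP zN Nmin.
have N0 : (0 < N)%N by case: (N) zN => // /eqP; rewrite expr0 oner_eq0.
have xpE q : x ^+ (p * q) = incl (z' ^+ q) by rewrite exprM -zE rmorphXn.
exists (x ^+ N), (y - x * w); apply: explicit_pencil => //.
- apply: aug_indepP => //.
    by rewrite -scaleN1r meas_addE meas_scaleE aug_mul x0 y0 mul0r mulr0 addr0.
  (* Modulo m^2, y - x w is y minus the augmentation of w times x, which shifts the constant c. *)
  move=> c; apply: contra (yM (c + meas_fun w 1)) => h.
  have -> : y - (c + (meas_fun w 1 : k)) *: x =
      (y - x * w - c *: x) + x * (w - (meas_fun w 1 : k)%:A).
    by rewrite mulrBr -scalerAr mulr1 scalerDl opprD addrA [RHS]addrA [y - x * w - _]addrAC subrK.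
  rewrite memvD // mem_augsq // -scaleN1r meas_addE !meas_scaleE meas_fun1 mulr1.
  by rewrite mulN1r subrr.
- by rewrite (frobD char_k cU) (frobN char_k) (exprM_meas cU) wE subrr.
- by rewrite xpE zN linear0.
move=> q f qN; rewrite xpE => xf.
(* In a basis of kU over kX the coordinates of f are killed by z'^q, which is nonzero as q < N. So
   they are not units, and are divisible by z', that is, by x^p in kU. *)
have [m [e [span free]]] := measures_free cX uX.
have [r fE] := span f.
have zr i : z' ^+ q * r i = 0.
  apply: (free (fun i => z' ^+ q * r i)); rewrite -[RHS]xf fE mulr_sumr.
  by apply: eq_bigr => j _; rewrite rmorphM mulrA.
have /choice[s sE] : forall i, exists s, r i = z' * s.
  move=> i; apply: nakX; apply/eqP/negPn/negP => /(aug_unit char_k cX nilX)[v rv].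
  have : z' ^+ q == 0 by rewrite -[_ ^+ q]mulr1 -rv mulrA zr mul0r.
  by move/Nmin; rewrite leqNgt qN.
exists (x ^+ p.-1 * \sum_i incl (s i) * e i); rewrite fE mulrA -exprS prednK // -zE.
by rewrite mulr_sumr; apply: eq_bigr => i _; rewrite sE rmorphM mulrA.
Qed.
End TwoExact.

(** * p-points *)

Lemma incl_alg (k : fieldType) (G : finGroupScheme k) (U : subgroupScheme G) (c : k) :
  incl (c%:A : measures U) = c%:A :> measures G.
Proof. by rewrite linearZ rmorph1. Qed.

Section CompSubgroup.
Variables (k : fieldType) (G : finGroupScheme k) (Z : subgroupScheme G) (U : subgroupScheme Z).

Fact comp_restr_surj b : exists a, (restr U \o restr Z) a = b.
Proof. by have [c <-] := restr_surj b; have [a <-] := restr_surj c; exists a. Qed.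

Fact comp_restr_comul a : comul U ((restr U \o restr Z) a) =
  tlift (fun x y => tpure ((restr U \o restr Z) x) ((restr U \o restr Z) y)) (comul G a).
Proof.
rewrite /= restr_comul restr_comul linear_tlift; apply: eq_tlift => x y.
rewrite [LHS]tlift_pure //.
  by move=> w c u v; rewrite linearP tpure_linl.
by move=> w c u v; rewrite linearP tpure_linr.
Qed.

Fact comp_restr_counit a : counit U ((restr U \o restr Z) a) = counit G a.
Proof. by rewrite /= !restr_counit. Qed.

Definition comp_subgroup : subgroupScheme G :=
  SubgroupScheme comp_restr_surj comp_restr_comul comp_restr_counit.

Lemma comp_incl (u : measures U) : @incl k G comp_subgroup u = incl (incl u : measures Z).
Proof. by apply: measP => a; rewrite !inclE. Qed.
End CompSubgroup.

Lemma measures_mulC_abelian (k : fieldType) (G : finGroupScheme k) :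
  (forall u v : measures G, u * v = v * u) -> abelian_scheme G.
Proof.
move=> cG R g h a; rewrite /point_mul.
have sym : tlift (fun x y => tpure y x) (comul G a) = comul G a.
  apply/eqP; rewrite -subr_eq0; apply/eqP/tensor_eq0 => u v; rewrite linearB linear_tlift /=.
  apply/eqP; rewrite subr_eq0; apply/eqP.
  transitivity (meas_fun (v * u) a).
    by rewrite [RHS]meas_mulE; apply: eq_tlift => x y; rewrite [LHS]evp_pure mulrC.
  by rewrite cG [LHS]meas_mulE.
rewrite -[in LHS]sym linear_tlift; apply: eq_tlift => x y; rewrite [LHS]tlift_pure.
- by rewrite mulrC.
- by move=> w c u v; rewrite linearP mulrDl scalerAl.
- by move=> w c u v; rewrite linearP mulrDr scalerAr.
Qed.

Section PPointFacts.
Variables (k : fieldType) (p : nat).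
Hypothesis p_gt1 : (1 < p)%N.

Lemma iter_act (B : algType k) (N : fdModule B) (b : B) n x :
  iter n (act N b) x = act N (b ^+ n) x.
Proof.
elim: n x => [|n IH] x; first by rewrite expr0 act1 id_lfunE.
by rewrite iterS IH exprS actM comp_lfunE.
Qed.

Lemma ppoint_exp (G : finGroupScheme k) (alpha : ppoint p G) : alpha (Ap_t k p) ^+ p = 0.
Proof. by rewrite -rmorphXn Ap_t_exp // rmorph0. Qed.

Lemma pull_projectiveE (G : finGroupScheme k) (alpha : ppoint p G) (N : fdModule (measures G)) :
  projective (lmod_of (pull alpha N)) <-> exactp (act N (alpha (Ap_t k p))) p.
Proof. exact: (projectiveE p_gt1 (pull alpha N)). Qed.

Lemma ppoint_exactp (G : finGroupScheme k) (alpha : ppoint p G) :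
  exactp (amull (alpha (Ap_t k p))) p.
Proof.
exact: ((pull_projectiveE alpha (regular (measures G))).1 (@ppoint_proj k p G alpha)).
Qed.

Lemma ex_ppoint (G : finGroupScheme k) (U : subgroupScheme G) (w : measures U) :
  abelian_scheme U -> unipotent U -> w ^+ p = 0 -> exactp (amull (incl w)) p ->
  exists alpha : ppoint p G, alpha (Ap_t k p) = incl w.
Proof.
move=> abU uU wp ex; have iwp : (incl w : measures G) ^+ p = 0.
  by rewrite -rmorphXn wp rmorph0.
have [f [ft fE]] := ex_Ap_morph p_gt1 iwp.
have fproj : projective (lmod_of (pull f (regular (measures G)))).
  apply/(projectiveE p_gt1 (pull f (regular (measures G)))).
  rewrite -ft in ex; exact: ex.
have fU : exists U : subgroupScheme G, [/\ abelian_scheme U, unipotent U &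
    forall a, exists u : measures U, f a = incl u].
  exists U; split=> // q; rewrite fE; exists (\sum_(i < size q) (q`_i)%R *: w ^+ i).
  by rewrite linear_sum; apply: eq_bigr => i _; rewrite linearZ /= rmorphXn.
by exists (PPoint fproj fU).
Qed.

Lemma exactp_act_unit (U : finGroupScheme k) (cU : forall u v : measures U, u * v = v * u)
    (N : fdModule (measures U)) (b c d : measures U) : c * d = 1 ->
  exactp (act N b) p -> exactp (act N (b * c)) p.
Proof.
move=> cd ex x bcx; have [|y yE] := ex (act N c x).
  by rewrite -comp_lfunE -actM.
exists (act N (d ^+ p) y); rewrite iter_act -comp_lfunE -actM.
(* The factor d^(p-1) cancels c^(p-1); the remaining d turns c x back into x. *)
have -> : (b * c) ^+ p.-1 * d ^+ p = d * b ^+ p.-1.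
  rewrite exprMn_comm; last exact: cU.
  rewrite -[in d ^+ p](prednK (ltnW p_gt1)) exprSr !mulrA -[_ * _ * d ^+ _]mulrA.
  rewrite -exprMn_comm; last exact: cU.
  by rewrite cd expr1n mulr1 cU.
rewrite actM comp_lfunE -iter_act -yE -comp_lfunE -actM.
by rewrite cU cd act1 id_lfunE.
Qed.
End PPointFacts.

(** Dimension r - 1 means a chain with r members. As r >= 2, its first two members are distinct: a
    point of the first and a point of the second outside it are different classes. *)
Lemma rk_au_inequivalent (k : fieldType) (p : nat) (Z : finGroupScheme k) r :
  has_rk_au p Z r -> (2 <= r)%N -> exists U : subgroupScheme Z,
  [/\ abelian_scheme U, unipotent U & exists alpha beta : ppoint p U, ~ pp_equiv alpha beta].
Proof.
move=> [[U [abU uU [m [[C [Cirr Cinc]] _] rm]]] _] r2; exists U; split=> //.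
have mr : m = r by move: rm => /addIr[].
rewrite mr in Cirr Cinc.
have [sub ninc] := Cinc 0%N r2.
have [_ [c0 c0C] _] := Cirr 0%N (ltnW r2).
have [c1 c1C c1C0] : exists2 c, C 1%N c & ~ C 0%N c.
  by apply: contrapT => h; apply: ninc => c cC; apply: contrapT => nc; apply: h; exists c.
apply: contrapT => alleq; apply: c1C0; suff <- : c0 = c1 by [].
have eqv (x y : ppoint p U) : pp_equiv x y.
  by apply: contrapT => h; apply: alleq; exists x, y.
have : sval c0 = sval c1.
  have [[a ->] [b ->]] := (svalP c0, svalP c1).
  by apply/seteqP; split=> z _; apply: eqv.
case: c0 c1 {c0C c1C} => s hs [t ht] /= st; case: _ / st ht => ht.
by rewrite (Prop_irrelevance hs ht).
Qed.

Section CentralPencil.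
Variables (k : closedFieldType) (p : nat) (char_k : p \in [pchar k]).
Let p_pr : prime p := pcharf_prime char_k.
Let p_gt0 := prime_gt0 p_pr.
Let p_gt1 := prime_gt1 p_pr.

(** With one generator, divisibility in kU is total, so up to symmetry beta(t) = alpha(t) c. By
    [exactp_factor_unit] c is a unit, which makes alpha and beta equivalent. *)
Lemma inequivalent_indep (U : finGroupScheme k) (alpha beta : ppoint p U) :
  abelian_scheme U -> unipotent U -> ~ pp_equiv alpha beta ->
  exists x1 x2 : measures U, aug_indep x1 x2.
Proof.
move=> /abelian_measures_mulC cU uU; have nil := unipotent_nil cU uU.
have [[x gx]|//] := @aug_gen_or_indep k U; case.
wlog [c bc] : alpha beta / exists c, beta (Ap_t k p) = alpha (Ap_t k p) * c.
  move=> W; have [|ba] := aug_chain_dvd char_k cU nil (alpha (Ap_t k p)) (beta (Ap_t k p)) gx.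
    exact: W.
  by move=> N; have := W beta alpha ba N; tauto.
have ex := @ppoint_exactp k p p_gt1 U beta; rewrite bc in ex.
have c0 := exactp_factor_unit char_k cU nil (ppoint_exp p_gt1 alpha) ex.
have [d cd] := aug_unit char_k cU nil c0.
move=> N; rewrite !(pull_projectiveE p_gt1) bc; split; first exact: exactp_act_unit cd.
move=> /(exactp_act_unit p_gt1 cU (etrans (cU d c) cd)).
by rewrite -mulrA cd mulr1.
Qed.

Section ProductSubgroup.
Variables (G : finGroupScheme k) (U C : subgroupScheme G).
Hypothesis UC : forall (u : measures U) (v : measures C), incl u * incl v = incl v * incl u :> measures G.
Hypotheses (cU : forall u v : measures U, u * v = v * u) (cC : forall u v : measures C, u * v = v * u).
Hypotheses (uU : unipotent U) (uC : unipotent C).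

Let SU : {vspace measures G} := limg (linfun (@incl k G U)).
Let SC : {vspace measures G} := limg (linfun (@incl k G C)).

Let memSU x : x \in SU <-> exists u : measures U, x = incl u.
Proof.
split=> [/memv_imgP[u _ ->]|[u ->]]; first by exists u; rewrite lfunE.
by rewrite -(lfunE (@incl k G U)) memv_img ?memvf.
Qed.
Let memSC x : x \in SC <-> exists u : measures C, x = incl u.
Proof.
split=> [/memv_imgP[u _ ->]|[u ->]]; first by exists u; rewrite lfunE.
by rewrite -(lfunE (@incl k G C)) memv_img ?memvf.
Qed.

(** The measure algebra of the subgroup generated by the commuting subgroups U and C. *)
Let S : {vspace measures G} := (SU * SC)%VS.

Let S_incl (u : measures U) (v : measures C) : incl u * incl v \in S.
Proof. by rewrite memv_mul //; [apply/memSU; exists u | apply/memSC; exists v]. Qed.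

Let S_ind (P : measures G -> Prop) : P 0 -> (forall c x y, P x -> P y -> P (c *: x + y)) ->
  (forall (u : measures U) (v : measures C), P (incl u * incl v)) -> forall x, x \in S -> P x.
Proof.
move=> P0 PD Puv x; have [W WP] := ex_vspace P0 PD.
move=> xS; apply/WP; apply: subvP xS; apply/prodvP => _ _ /memSU[u ->] /memSC[v ->].
exact/WP.
Qed.

Let S1 : 1 \in S.
Proof. by have := S_incl 1 1; rewrite !rmorph1 mulr1. Qed.

Let S_swap (u u' : measures U) (v v' : measures C) :
  (incl u * incl v) * (incl u' * incl v') = incl (u * u') * incl (v * v') :> measures G.
Proof. by rewrite !rmorphM !mulrA; congr (_ * _); rewrite -!mulrA UC. Qed.

Let SM x y : x \in S -> y \in S -> x * y \in S.
Proof.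
move=> xS; move: y; apply: S_ind => [|c a b aS bS|u v].
- by rewrite mulr0 mem0v.
- by rewrite mulrDr -scalerAr memvD ?memvZ.
move: x xS; apply: S_ind => [|c a b aS bS|u' v'].
- by rewrite mul0r mem0v.
- by rewrite mulrDl -scalerAl memvD ?memvZ.
by rewrite S_swap S_incl.
Qed.

Let SD a x : x \in S -> Dm a x \in S.
Proof.
move: x; apply: S_ind => [|c x y xS yS|u v].
- by rewrite linear0 mem0v.
- by rewrite linearP memvD ?memvZ.
rewrite DmM /tlift; apply: memv_suml => i _; apply: memv_suml => j _.
by rewrite memvZ // !Dm_incl S_incl.
Qed.

Let W : subgroupScheme G := quotSubgroup (SubBialg S1 SM SD).
Let memW x : x \in S <-> exists w : measures W, x = incl w.
Proof. exact: (@quotSubgroupP k G (SubBialg S1 SM SD)). Qed.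

Let S_comm x y : x \in S -> y \in S -> x * y = y * x.
Proof.
move=> xS; move: y; apply: S_ind => [|c a b aS bS|u v].
- by rewrite mulr0 mul0r.
- by rewrite mulrDr mulrDl -scalerAr -scalerAl aS bS.
move: x xS; apply: S_ind => [|c a b aS bS|u' v'].
- by rewrite mulr0 mul0r.
- by rewrite mulrDr mulrDl -scalerAr -scalerAl aS bS.
by rewrite !S_swap cU cC.
Qed.

Let cW (w w' : measures W) : w * w' = w' * w.
Proof.
apply: (@incl_inj k G W); rewrite !rmorphM /=; apply: S_comm; apply/memW.
  by exists w.
by exists w'.
Qed.

Let pow_scalar (X : finGroupScheme k) (cX : forall u v : measures X, u * v = v * u)
    (uX : unipotent X) (x : measures X) :
  exists e, forall e', (e <= e')%N -> x ^+ (p ^ e') = ((meas_fun x 1 : k) ^+ (p ^ e'))%:A.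
Proof.
set c : k := meas_fun x 1.
have [n nE] : exists n, (x - c%:A) ^+ n = 0.
  apply: (unipotent_nil cX uX); rewrite -scaleN1r meas_addE !meas_scaleE.
  by rewrite meas_fun1 mulr1 mulN1r subrr.
exists n => e ne; rewrite -{1}[x](subrK c%:A) (frobD_iter char_k cX).
rewrite (_ : (x - _) ^+ (p ^ e) = 0) ?add0r ?exprZn ?expr1n //.
by rewrite -(subnK (leq_trans ne (ltnW (ltn_expl e p_gt1)))) exprD nE mulr0.
Qed.

Let nilW (w : measures W) : meas_fun w 1 = 0 -> exists n, w ^+ n = 0.
Proof.
(* Nilpotency cannot be checked on the spanning products, whose augmentation may be nonzero. Having
   p^e-th powers equal to those of the augmentation makes sense for every element and is additive by
   Frobenius. *)
pose P (x : measures G) := exists2 w : measures W, x = incl w &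
  exists e, forall e', (e <= e')%N -> w ^+ (p ^ e') = ((meas_fun w 1 : k) ^+ (p ^ e'))%:A.
have PS x : x \in S -> P x.
  move: x; apply: S_ind => [|c _ _ [x -> [e xe]] [y -> [e' ye]]|u v].
  - exists 0; first by rewrite linear0.
    by exists 0%N => e _; rewrite meas_fun0 !expr0n gtn_eqF ?expn_gt0 ?p_gt0 // scale0r.
  - exists (c *: x + y); first by rewrite linearP.
    exists (maxn e e') => n; rewrite geq_max => /andP[en e'n].
    rewrite (frobD_iter char_k cW) exprZn xe // ye // meas_addE meas_scaleE.
    have kD a b : (a + b : k) ^+ (p ^ n) = a ^+ (p ^ n) + b ^+ (p ^ n).
      elim: (n) => [|j IH]; first by rewrite !expr1.
      by rewrite expnSr !exprM IH; apply: (pFrobenius_autD_comm char_k (mulrC _ _)).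
    by rewrite kD exprMn scalerDl scalerA.
  - have [y yE] : exists y : measures W, incl u * incl v = incl y :> measures G.
      exact/memW/S_incl.
    exists y => //; have [e ue] := pow_scalar cU uU u; have [e' ve] := pow_scalar cC uC v.
    exists (maxn e e') => n; rewrite geq_max => /andP[en e'n].
    apply: (@incl_inj k G W); rewrite rmorphXn /= -yE exprMn_comm; last exact: UC.
    have y1 : meas_fun y 1 = meas_fun u 1 * meas_fun v 1.
      by rewrite -(@incl1E k G W y) -yE aug_mul !incl1E.
    rewrite -!rmorphXn ue // ve // y1 exprMn.
    by rewrite /= !incl_alg -scalerAl mul1r scalerA.
move=> w0; have [|w' /incl_inj <- [e we]] := PS (incl w); first by apply/memW; exists w.
by exists (p ^ e)%N; rewrite we // w0 expr0n gtn_eqF ?expn_gt0 ?p_gt0 // scale0r.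
Qed.

Lemma ex_product_subgroup : exists W : subgroupScheme G,
  [/\ abelian_scheme W, unipotent W &
     forall (u : measures U) (v : measures C), exists w : measures W, incl w = incl u + incl v :> measures G].
Proof.
exists W; split; first exact: measures_mulC_abelian.
  exact: nil_unipotent.
move=> u v; have /memW[w ->] : incl u + incl v \in S; last by exists w.
have := S_incl u 1; have := S_incl 1 v; rewrite !rmorph1 mul1r mulr1 => vS uS.
exact: memvD.
Qed.
End ProductSubgroup.
End CentralPencil.

(** By induction, f^(l+1) V = f g^l V = g^l f V = g^l g V. *)
Lemma limg_lfun_pow (k : fieldType) (V : vectType k) (f g : 'End(V)) l :
  (forall x, f (g x) = g (f x)) -> limg f = limg g ->
  limg (lfun_pow f l) = limg (lfun_pow g l).
Proof.
move=> fg fgE; elim: l => [//|l IH].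
rewrite /= limg_comp IH -limg_comp.
have -> : (f \o lfun_pow g l)%VF = (lfun_pow g l \o f)%VF.
  apply/lfunP => x; rewrite !comp_lfunE !lfun_powE.
  by elim: l {IH} => //= l IH; rewrite fg IH.
rewrite limg_comp fgE -limg_comp; congr (limg _).
by apply/lfunP => x; rewrite !comp_lfunE !lfun_powE -iterSr.
Qed.

Lemma amull_linear (k : fieldType) (F : falgType k) (x y : F) c :
  amull (x + c *: y) = amull x + c *: amull y.
Proof. by apply/lfunP => z; rewrite add_lfunE scale_lfunE !amullE mulrDl scalerAl. Qed.

(** * Equal images from a central pencil *)

Section Main.
Variables (k : closedFieldType) (p : nat) (char_k : p \in [pchar k]).
Let p_pr : prime p := pcharf_prime char_k.
Let p_gt0 := prime_gt0 p_pr.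
Let p_gt1 := prime_gt1 p_pr.
Variables (G : finGroupScheme k) (Z : subgroupScheme G) (Z_center : is_center Z).
Variables (U : subgroupScheme Z) (abU : abelian_scheme U) (uU : unipotent U).
Variables (b1 b2 : measures U) (bpencil : exact_pencil p b1 b2).

Let C := comp_subgroup U.
Let cU : forall u v : measures U, u * v = v * u := abelian_measures_mulC abU.
Let w s t : measures U := s *: b1 + t *: b2.

Let wp s t : w s t ^+ p = 0.
Proof.
have [b1p b2p _] := bpencil.
by rewrite (frobD char_k cU) !exprZn b1p b2p !scaler0 addr0.
Qed.

Let wex s t : (s != 0) || (t != 0) -> exactp (amull (w s t)) p.
Proof. by have [_ _] := bpencil; apply. Qed.

Let central (u : measures C) (v : measures G) : incl u * v = v * incl u.
Proof. by rewrite comp_incl center_measures_mulC. Qed.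

(** The same element of kU is used twice: as a p-point of Z, where equal images apply, and through
    [C] as a p-point of G, where constant rank applies. *)
Let ex_ppointZ s t : (s != 0) || (t != 0) ->
  exists beta : ppoint p Z, beta (Ap_t k p) = incl (w s t).
Proof.
by move=> st; apply: ex_ppoint => //; apply: incl_exactp => //; apply: wex.
Qed.

Let ex_ppointC s t : (s != 0) || (t != 0) ->
  exists beta : ppoint p G, beta (Ap_t k p) = @incl k G C (w s t).
Proof.
by move=> st; apply: ex_ppoint => //; apply: (@incl_exactp k G C) => //; apply: wex.
Qed.

(** Centrality of c is used twice: it gives (c + u a)^p = c^p + u^p a^p = 0, and it places c and a
    in the measures of one abelian unipotent subgroup. Exactness for generic u is [cofin_exactp]. *)
Let ex_ppointG s t (alpha : ppoint p G) : (s != 0) || (t != 0) ->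
  cofin (fun u : k => exists gamma : ppoint p G,
    gamma (Ap_t k p) = @incl k G C (w s t) + u *: alpha (Ap_t k p)).
Proof.
move=> st; set a := alpha _; set c := @incl k G C _.
have cp : c ^+ p = 0 by rewrite -rmorphXn wp rmorph0.
have ap : a ^+ p = 0 by apply: ppoint_exp.
have sp u : (c + u *: a) ^+ p = 0.
  have com : GRing.comm c (u *: a) by apply: central.
  have := pFrobenius_autD_comm (pchar_measures char_k G) com; rewrite !pFrobenius_autE.
  by move=> ->; rewrite exprZn cp ap scaler0 addr0.
have cex : exactp (amull c) p by apply: (@incl_exactp k G C) => //; apply: wex.
have [||S SP] := @cofin_exactp k _ (amull c) (amull a) p p_gt0 _ _ cex.
- by move=> x; rewrite iter_amull cp mul0r.
- by move=> u x; rewrite -amull_linear iter_amull sp mul0r.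
have [V [abV uV aV]] := ppoint_abelian_unipotent alpha.
have [a' aE] := aV (Ap_t k p).
have UC (x : measures V) (y : measures C) : incl x * incl y = incl y * incl x :> measures G.
  by rewrite central.
have [W [abW uW WP]] := ex_product_subgroup char_k UC (abelian_measures_mulC abV) cU uV uU.
exists S => u /SP; rewrite -amull_linear => ex.
have [x xE] := WP (u *: a') (w s t).
have {}xE : incl x = c + u *: a by rewrite xE linearZ /= -aE addrC.
rewrite -xE in ex *; apply: ex_ppoint => //.
by apply: (@incl_inj k G W); rewrite rmorphXn /= xE sp linear0.
Qed.

Lemma central_pencil_equal_images (M : fdModule (measures G)) :
  constant_rank p M -> equal_images p (restrict Z M) -> equal_images p M.
Proof.
move=> crk eqim l lp; have [Vl VlP] := eqim l lp.
have [|V VP] := eqim 1%N; first by rewrite leqnn -ltnS prednK.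
exists Vl => alpha.
pose a := act M (alpha (Ap_t k p)).
pose b s t := act M (@incl k G C (w s t)).
have bZ s t : (s != 0) || (t != 0) -> exists beta : ppoint p Z,
    pp_op (restrict Z M) beta = b s t.
  move=> /ex_ppointZ[beta betaE]; exists beta; rewrite /pp_op /b comp_incl -betaE //.
have bV s t : (s != 0) || (t != 0) -> limg (b s t) = V.
  move=> /bZ[beta <-]; rewrite -(VP beta) /lfun_pow /=; congr (limg _).
  by apply/lfunP => x; rewrite comp_lfunE id_lfunE.
have bE s t : b s t = s *: act M (@incl k G C b1) + t *: act M (@incl k G C b2).
  by rewrite /b !linearD !linearZ.
have rk s t : (s != 0) || (t != 0) ->
    cofin (fun u : k => \dim (limg (b s t + u *: a)%R) <= \dim V)%N.
  move=> st; have [S SP] := ex_ppointG alpha st; exists S => u /SP[gamma gE].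
  have [delta dE] := ex_ppointC st.
  rewrite -(bV s t st) (_ : b s t + u *: a = pp_op M gamma); last first.
    by rewrite /pp_op gE linearD linearZ.
  have -> : b s t = pp_op M delta by rewrite /pp_op dE.
  by rewrite (crk gamma delta).
have st10 : (1 != 0 :> k) || (0 != 0 :> k) by rewrite oner_eq0.
have aV : (limg a <= V)%VS.
  apply: (@surjective_pencil_image k M (act M (@incl k G C b1)) (act M (@incl k G C b2))).
    by move=> s t st; rewrite -bE bV.
  by move=> s t st; rewrite -bE; apply: rk.
have [delta dE] := ex_ppointC st10; have [beta bbE] := bZ 1 0 st10.
(* [alpha] and [delta] are p-points of G, so constant rank turns the inclusion im a <= V = im b into
   an equality. *)
have {}aV : limg a = limg (b 1 0).
  apply/eqP; rewrite eqEdim bV // aV -(bV 1 0 st10).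
  have -> : b 1 0 = pp_op M delta by rewrite /pp_op dE.
  by rewrite (crk delta alpha) /pp_op -/a leqnn.
rewrite -(VlP beta) bbE; apply: limg_lfun_pow => // x.
by rewrite -!comp_lfunE -!actM central.
Qed.
End Main.

Local Close Scope ring_scope.

Theorem theorem7p4 (k : closedFieldType) (p : nat)
  (char_k : p \in [pchar k]%R)
  (G : finGroupScheme k) (Z : subgroupScheme G) (Z_center : is_center Z)
  (r : nat) (rk_Z : has_rk_au p Z r) (r_ge2 : 2 <= r)
  (M : fdModule (measures G))
  (M_constant_rank : constant_rank p M)
  (MZ_equal_images : equal_images p (restrict Z M)) :
  equal_images p M.
Proof.
have [U [abU uU [alpha [beta ab]]]] := rk_au_inequivalent rk_Z r_ge2.
have indep := inequivalent_indep char_k abU uU ab.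
have cU := abelian_measures_mulC abU.
have [b1 [b2 bpencil]] := ex_exact_pencil char_k cU (unipotent_nil cU uU) indep.
exact: (central_pencil_equal_images char_k Z_center abU uU bpencil).
Qed.
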